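(* Let $T=\mathcal{N}\mathcal{C}$ be a model operator on $\mathcal{H}=\mathcal{H}_1\oplus\mathcal{H}_2\neq\{0\}$ as described in the context, with corresponding operators $N_1,N_2,C_1,C_2$. (i) If $T$ is irreducible, then $\dim\mathcal{H}_1=1$, or equivalently, $\dim\mathcal{H}_2=1$. (ii) If $\dim\mathcal{H}_1=1$ and $N_1$ on $\mathcal{H}_1$ is not real (that is, $N_1$ is multiplication by a non-real complex number), then $T$ is irreducible. (iii) If $T$ is irreducible, then $T$ is unitarily equivalent to an operator $T_z$ for some $z\in\mathbb{C}$, $z\ne 0$, with $0<\arg z\le\frac{\pi}{2}$, where $T_z$ is the antilinear operator on $\mathbb{C}^2$ given by $T_z(x_1,x_2)=(\overline{z}\,\overline{x_2},z\,\overline{x_1})$.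
   Context: Hilbert spaces are complex; operators may be unbounded, with products on natural domains and equalities including domains. Antilinear means $A(\alpha x+\beta y)=\overline{\alpha}\,Ax+\overline{\beta}\,Ay$ for $\alpha,\beta\in\mathbb{C}$. A conjugation on a Hilbert space is an everywhere defined antilinear isometric operator $C$ with $C^2=I$. Model operator: $N_1,N_2$ are (possibly unbounded) normal linear operators on Hilbert spaces $\mathcal{H}_1,\mathcal{H}_2$; $\mathcal{N}=\begin{pmatrix}N_1&0\\0&N_2\end{pmatrix}$ on $\mathcal{H}_1\oplus\mathcal{H}_2$; $\mathcal{C}=\begin{pmatrix}0&C_2\\C_1&0\end{pmatrix}$ is a conjugation on $\mathcal{H}_1\oplus\mathcal{H}_2$, with $C_1:\mathcal{H}_1\to\mathcal{H}_2$ and $C_2:\mathcal{H}_2\to\mathcal{H}_1$, such that $\mathcal{N}\mathcal{C}=\mathcal{C}\mathcal{N}$; and $T:=\mathcal{N}\mathcal{C}=\begin{pmatrix}0&N_1C_2\\N_2C_1&0\end{pmatrix}$. An operator $S$ on $\mathcal{H}$ is irreducible if there is no orthogonal decomposition $S=S_1\oplus S_2$ on $\mathcal{H}=\mathcal{G}_1\oplus\mathcal{G}_2$ with operators $S_1,S_2$ on $\mathcal{G}_1,\mathcal{G}_2$ and $\mathcal{G}_1,\mathcal{G}_2\neq\{0\}$ (the domain of $S_1\oplus S_2$ being $\mathcal{D}(S_1)\oplus\mathcal{D}(S_2)$). $T$ and $T'$ are unitarily equivalent if $UTU^*=T'$ for some linear unitary $U$. *)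

(* Defs.v *)
From HB Require Import structures.
From mathcomp Require Import all_boot all_order all_algebra.
From mathcomp Require Import all_classical all_reals all_analysis.
From mathcomp Require Import complex ring lra.

Set Implicit Arguments.
Unset Strict Implicit.
Unset Printing Implicit Defensive.

Import Order.TTheory GRing.Theory Num.Theory Num.Def.
Import numFieldNormedType.Exports.
Local Open Scope classical_set_scope.
Local Open Scope complex_scope.
Local Open Scope ring_scope.

(* The inner product is linear in its first argument and conjugate-linear in
   the second one, as in [{dot H for conjC}]. *)
HB.mixin Record CompleteNormedModule_isHilbert (R : realType) H
    & CompleteNormedModule R[i] H := {
  dot : {dot H for @conjC R[i]} ;
  dotxx : forall x : H, dot x x = `|x| ^+ 2
}.

#[short(type="hilbertType")]
HB.structure Definition Hilbert (R : realType) :=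
  {H of CompleteNormedModule_isHilbert R H & CompleteNormedModule R[i] H}.

(* An alias of [R[i]]: completeness cannot be declared on [R[i]^o], because
   the canonical instance of regular modules is already that of [R^o]. *)
Definition Chilbert (R : realType) : Type := R[i].

Section complex_hilbert.
Variable R : realType.
Local Notation C := (Chilbert R).

HB.instance Definition _ := NormedModule.copy C (R[i])^o.

Lemma normr_Re (z : R[i]) : (`|complex.Re z|)%:C <= `|z|.
Proof.
case: z => a b; rewrite normc_def /= lecR -(sqrtr_sqr a) ler_sqrt ?lerDl //;
by rewrite ?addr_ge0 ?sqr_ge0.
Qed.

Lemma normr_Im (z : R[i]) : (`|complex.Im z|)%:C <= `|z|.
Proof.
case: z => a b; rewrite normc_def /= lecR -(sqrtr_sqr b) ler_sqrt ?lerDr //;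
by rewrite ?addr_ge0 ?sqr_ge0.
Qed.

Lemma normr_ReIm (z : R[i]) :
  `|z| <= (`|complex.Re z| + `|complex.Im z|)%:C.
Proof.
case: z => a b; rewrite normc_def /= lecR.
rewrite -[X in _ <= X]ger0_norm ?addr_ge0 // -sqrtr_sqr.
rewrite ler_sqrt ?sqr_ge0 // sqrrD -(real_normK (num_real a)).
by rewrite -(real_normK (num_real b)) addrAC lerDl mulrn_wge0 ?mulr_ge0.
Qed.

Lemma complex_cauchy_cvg (F : set_system C) :
  ProperFilter F -> cauchy F -> cvg F.
Proof.
move=> FF /cauchy_ballP Fc.
have cRe : cauchy (@complex.Re R @ F).
  apply/cauchy_ballP => e e0; rewrite near_map2 /=.
  have e0' : 0 < e%:C :> R[i] by rewrite ltcR.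
  apply: filterS (Fc _ e0') => -[x y] /=; rewrite -!ball_normE /= => h.
  rewrite -ltcR; apply: le_lt_trans h.
  by rewrite -raddfB normr_Re.
have cIm : cauchy (@complex.Im R @ F).
  apply/cauchy_ballP => e e0; rewrite near_map2 /=.
  have e0' : 0 < e%:C :> R[i] by rewrite ltcR.
  apply: filterS (Fc _ e0') => -[x y] /=; rewrite -!ball_normE /= => h.
  rewrite -ltcR; apply: le_lt_trans h.
  by rewrite -raddfB normr_Im.
have /cauchy_cvgP/cvg_ex [/= a aP] := cRe.
have /cauchy_cvgP/cvg_ex [/= b bP] := cIm.
move/cvgrPdist_lt in aP; move/cvgrPdist_lt in bP.
apply/cvg_ex; exists (a +i* b : C); apply/cvgrPdist_lt => /= e e0.
have [r r0 er] : exists2 r : R, 0 < r & e = r%:C.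
  exists (complex.Re e); first by move: e0; rewrite ltcE => /andP[].
  by move: e0; case: e => x y; rewrite ltcE /= => /andP[/eqP ->].
rewrite er.
have r2 : 0 < r / 2 by rewrite divr_gt0.
near=> x.
apply: le_lt_trans (normr_ReIm _) _; rewrite ltcR !raddfB /=.
rewrite [ltRHS]splitr ltrD //; near: x; [exact: aP|exact: bP].
Unshelve. all: by end_near. Qed.

HB.instance Definition _ := Uniform_isComplete.Build C complex_cauchy_cvg.

Definition dotC (x y : C) : R[i] := (x : R[i]) * (y : R[i])^*.

Lemma dotC_bilinear : bilinear_for *%R (@conjC R[i] \; *%R) dotC.
Proof.
by split=> u a x y; rewrite /dotC /= ?rmorphD ?rmorphM /=; rewrite /GRing.scale /=; ring.
Qed.

HB.instance Definition _ :=
  bilinear_isBilinear.Build R[i] C C R[i] *%R (@conjC R[i] \; *%R) dotC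
    dotC_bilinear.

Lemma dotC_hermitian (x y : C) : dotC x y = (-1) ^+ false * (dotC y x)^*.
Proof. by rewrite expr0 mul1r /dotC rmorphM /= conjCK mulrC. Qed.

HB.instance Definition _ :=
  @isHermitianSesquilinear.Build R[i] C false (@conjC R[i]) dotC
    dotC_hermitian.

Lemma dotC_gt0 (x : C) : x != 0 -> 0 < dotC x x.
Proof. by move=> x0; rewrite /dotC -normCK exprn_gt0 ?normr_gt0. Qed.

HB.instance Definition _ := isDotProduct.Build R[i] C dotC dotC_gt0.

Lemma dotCxx (x : C) : dotC x x = `|x| ^+ 2.
Proof. by rewrite /dotC -normCK. Qed.

HB.instance Definition _ :=
  @CompleteNormedModule_isHilbert.Build R C dotC dotCxx.

End complex_hilbert.

(* An alias of [H1 * H2] is needed because the product type already carries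
   the (equivalent, but not Hilbertian) max norm. *)
Definition hsum (R : realType) (H1 H2 : hilbertType R) : Type := (H1 * H2)%type.

Section hsum_hilbert.
Variables (R : realType) (H1 H2 : hilbertType R).
Local Notation H := (hsum H1 H2).

HB.instance Definition _ := GRing.Lmodule.copy H (H1 * H2)%type.

Definition hsum_norm (x : H) : R[i] := sqrtC (`|x.1| ^+ 2 + `|x.2| ^+ 2).

Lemma minkowski2 (a b c d : R[i]) : 0 <= a -> 0 <= b -> 0 <= c -> 0 <= d ->
  sqrtC ((a + c) ^+ 2 + (b + d) ^+ 2) <=
  sqrtC (a ^+ 2 + b ^+ 2) + sqrtC (c ^+ 2 + d ^+ 2).
Proof.
move=> a0 b0 c0 d0.
set p := sqrtC (a ^+ 2 + b ^+ 2); set q := sqrtC (c ^+ 2 + d ^+ 2).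
have p0 : 0 <= p by rewrite sqrtC_ge0 addr_ge0 ?exprn_ge0.
have q0 : 0 <= q by rewrite sqrtC_ge0 addr_ge0 ?exprn_ge0.
have pE : p ^+ 2 = a ^+ 2 + b ^+ 2 by rewrite sqrtCK.
have qE : q ^+ 2 = c ^+ 2 + d ^+ 2 by rewrite sqrtCK.
have key : a * c + b * d <= p * q.
  rewrite -(@ler_pXn2r _ 2) ?nnegrE ?addr_ge0 ?mulr_ge0 //.
  rewrite exprMn pE qE -subr_ge0.
  have -> : (a ^+ 2 + b ^+ 2) * (c ^+ 2 + d ^+ 2) - (a * c + b * d) ^+ 2 =
    (a * d - b * c) ^+ 2 by ring.
  by rewrite real_exprn_even_ge0 // rpredB // rpredM // ger0_real.
rewrite -(@ler_pXn2r _ 2) ?nnegrE ?sqrtC_ge0 ?addr_ge0 ?exprn_ge0 ?addr_ge0 //.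
rewrite sqrtCK (_ : (p + q) ^+ 2 = p ^+ 2 + q ^+ 2 + 2 * (p * q)); last by ring.
rewrite pE qE -subr_ge0.
have -> : a ^+ 2 + b ^+ 2 + (c ^+ 2 + d ^+ 2) + 2 * (p * q) -
  ((a + c) ^+ 2 + (b + d) ^+ 2) = 2 * (p * q - (a * c + b * d)) by ring.
by rewrite mulr_ge0 ?subr_ge0.
Qed.

Lemma hsum_normD x y : hsum_norm (x + y) <= hsum_norm x + hsum_norm y.
Proof.
apply: le_trans (minkowski2 _ _ _ _) => //.
rewrite ler_sqrtC ?qualifE /= ?addr_ge0 ?exprn_ge0 ?addr_ge0 //.
by rewrite lerD // ler_pXn2r ?nnegrE ?addr_ge0 // ler_normD.
Qed.

Lemma hsum_normZ (a : R[i]) x : hsum_norm (a *: x) = `|a| * hsum_norm x.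
Proof.
rewrite /hsum_norm /= !normrZ !exprMn -mulrDr rootCMl ?exprn_ge0 //.
by rewrite sqrCK.
Qed.

Lemma hsum_norm_eq0 x : hsum_norm x = 0 -> x = 0.
Proof.
move/eqP; rewrite /hsum_norm sqrtC_eq0 paddr_eq0 ?exprn_ge0 //.
rewrite !expf_eq0 /= !normr_eq0; case: x => x y /= /andP[/eqP -> /eqP ->].
by [].
Qed.

HB.instance Definition _ :=
  @Lmodule_isNormed.Build R[i] H hsum_norm hsum_normD hsum_normZ hsum_norm_eq0.

Lemma hsum_normE (x : H) : `|x| = sqrtC (`|x.1| ^+ 2 + `|x.2| ^+ 2).
Proof. by []. Qed.

Lemma hsum_norm_fst (x : H) : `|x.1| <= `|x|.
Proof.
rewrite hsum_normE -[leLHS]sqrCK // ler_sqrtC ?qualifE /= ?addr_ge0 ?exprn_ge0 //.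
by rewrite lerDl exprn_ge0.
Qed.

Lemma hsum_norm_snd (x : H) : `|x.2| <= `|x|.
Proof.
rewrite hsum_normE -[leLHS]sqrCK // ler_sqrtC ?qualifE /= ?addr_ge0 ?exprn_ge0 //.
by rewrite lerDr exprn_ge0.
Qed.

Lemma hsum_norm_le (x : H) : `|x| <= `|x.1| + `|x.2|.
Proof.
rewrite hsum_normE -[leRHS]sqrCK ?addr_ge0 //.
rewrite ler_sqrtC ?qualifE /= ?addr_ge0 ?exprn_ge0 ?addr_ge0 //.
by rewrite sqrrD addrAC lerDl mulrn_wge0 ?mulr_ge0.
Qed.

Lemma hsum_cauchy_cvg (F : set_system H) :
  ProperFilter F -> cauchy F -> cvg F.
Proof.
move=> FF /cauchy_ballP Fc.
have c1 : cauchy ((fun x : H => x.1) @ F).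
  apply/cauchy_ballP => e e0; rewrite near_map2 /=.
  apply: filterS (Fc _ e0) => -[x y] /=; rewrite -!ball_normE /= => h.
  exact: le_lt_trans (hsum_norm_fst (x - y)) h.
have c2 : cauchy ((fun x : H => x.2) @ F).
  apply/cauchy_ballP => e e0; rewrite near_map2 /=.
  apply: filterS (Fc _ e0) => -[x y] /=; rewrite -!ball_normE /= => h.
  exact: le_lt_trans (hsum_norm_snd (x - y)) h.
have /cauchy_cvgP/cvg_ex [/= a aP] := c1.
have /cauchy_cvgP/cvg_ex [/= b bP] := c2.
move/cvgrPdist_lt in aP; move/cvgrPdist_lt in bP.
apply/cvg_ex; exists ((a, b) : H); apply/cvgrPdist_lt => /= e e0.
have e2 : 0 < e / 2 by rewrite divr_gt0.
near=> x.
apply: le_lt_trans (hsum_norm_le _) _ => /=.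
rewrite [ltRHS]splitr ltrD //; near: x; [exact: aP|exact: bP].
Unshelve. all: by end_near. Qed.

HB.instance Definition _ := Uniform_isComplete.Build H hsum_cauchy_cvg.

Definition hsum_dot (x y : H) : R[i] := dot x.1 y.1 + dot x.2 y.2.

Lemma hsum_dot_bilinear : bilinear_for *%R (@conjC R[i] \; *%R) hsum_dot.
Proof.
split=> u a x y; rewrite /hsum_dot /=.
  by rewrite !linearPl /=; ring.
by rewrite !linearPr /=; ring.
Qed.

HB.instance Definition _ :=
  bilinear_isBilinear.Build R[i] H H R[i] *%R (@conjC R[i] \; *%R) hsum_dot
    hsum_dot_bilinear.

Lemma hsum_dot_hermitian (x y : H) :
  hsum_dot x y = (-1) ^+ false * (hsum_dot y x)^*.
Proof.
rewrite /hsum_dot expr0 mul1r rmorphD /=.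
by rewrite (hermitian_subproof x.1) (hermitian_subproof x.2) expr0 !mul1r.
Qed.

HB.instance Definition _ :=
  @isHermitianSesquilinear.Build R[i] H false (@conjC R[i]) hsum_dot
    hsum_dot_hermitian.

Lemma hsum_dotxx (x : H) : hsum_dot x x = `|x| ^+ 2.
Proof. by rewrite hsum_normE sqrtCK /hsum_dot !dotxx. Qed.

Lemma hsum_dot_gt0 (x : H) : x != 0 -> 0 < hsum_dot x x.
Proof. by move=> x0; rewrite hsum_dotxx exprn_gt0 ?normr_gt0. Qed.

HB.instance Definition _ := isDotProduct.Build R[i] H hsum_dot hsum_dot_gt0.

HB.instance Definition _ :=
  @CompleteNormedModule_isHilbert.Build R H hsum_dot hsum_dotxx.

End hsum_hilbert.

(* Only the values of [app] on [dom] are relevant. *)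
Record operator (U V : Type) := Operator { dom : set U ; app :> U -> V }.

Definition total_op (U V : Type) (f : U -> V) : operator U V := Operator setT f.

Definition op_eq (U V : Type) (A B : operator U V) : Prop :=
  dom A = dom B /\ forall x, dom A x -> A x = B x.

Definition op_comp (U V W : Type) (A : operator V W) (B : operator U V) :
    operator U W :=
  Operator [set x | dom B x /\ dom A (B x)] (fun x => A (B x)).

Definition graph (U V : Type) (A : operator U V) : set (U * V) :=
  [set p | dom A p.1 /\ p.2 = A p.1].

Section operators.
Variable R : realType.
Implicit Types H K : hilbertType R.

Definition semilinear_op H K (s : R[i] -> R[i]) (A : operator H K) : Prop :=
  dom A 0 /\
  forall (a b : R[i]) (x y : H), dom A x -> dom A y ->
    dom A (a *: x + b *: y) /\
    A (a *: x + b *: y) = s a *: A x + s b *: A y.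

Definition linear_op H K (A : operator H K) : Prop := semilinear_op idfun A.

Definition antilinear_op H K (A : operator H K) : Prop :=
  semilinear_op (@conjC R[i]) A.

(* The defining relation of [A* y = z]; it determines [z] when [dom A] is
   dense. *)
Definition adjoint_rel H K (A : operator H K) (y : K) (z : H) : Prop :=
  forall x, dom A x -> dot (A x) y = dot x z.

Definition adjoint H K (A : operator H K) : operator K H :=
  Operator [set y | exists z, adjoint_rel A y z]
           (fun y => xget 0 [set z | adjoint_rel A y z]).

Definition normal_op H (N : operator H H) : Prop :=
  [/\ linear_op N, dense (dom N), closed (graph N) &
      op_eq (op_comp (adjoint N) N) (op_comp N (adjoint N))].

Definition conjugation H (c : H -> H) : Prop :=
  [/\ antilinear_op (total_op c), (forall x, `|c x| = `|x|) & involutive c].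

Definition closed_subspace H (G : set H) : Prop :=
  [/\ G 0, (forall (a : R[i]) x y, G x -> G y -> G (a *: x + y)) & closed G].

Definition orthogonal_decomposition H (G1 G2 : set H) : Prop :=
  [/\ closed_subspace G1, closed_subspace G2,
      (forall x1 x2, G1 x1 -> G2 x2 -> dot x1 x2 = 0) &
      forall x, exists x1 x2, [/\ G1 x1, G2 x2 & x = x1 + x2]].

(* An operator on the Hilbert space [G], which is a closed subspace of [H]. *)
Definition operator_on H (G : set H) (A : operator H H) : Prop :=
  [/\ linear_op A \/ antilinear_op A, dom A `<=` G &
      forall x, dom A x -> G (A x)].

Definition is_orthogonal_sum H (S S1 S2 : operator H H) : Prop :=
  dom S = [set x | exists x1 x2, [/\ dom S1 x1, dom S2 x2 & x = x1 + x2]] /\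
  forall x1 x2, dom S1 x1 -> dom S2 x2 -> S (x1 + x2) = S1 x1 + S2 x2.

Definition reducible H (S : operator H H) : Prop :=
  exists (G1 G2 : set H) (S1 S2 : operator H H),
    [/\ orthogonal_decomposition G1 G2,
        (G1 <> [set 0]) /\ (G2 <> [set 0]),
        operator_on G1 S1, operator_on G2 S2 & is_orthogonal_sum S S1 S2].

Definition irreducible H (S : operator H H) : Prop := ~ reducible S.

Definition unitary H K (U : {linear H -> K}) : Prop :=
  (forall x y, dot (U x) (U y) = dot x y) /\ (forall y, exists x, U x = y).

Definition unitarily_equivalent H K (A : operator H H) (B : operator K K) :
    Prop :=
  exists U : {linear H -> K}, unitary U /\
    op_eq (op_comp (total_op U) (op_comp A (adjoint (total_op U)))) B.

Definition has_dim H (n : nat) : Prop :=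
  exists e : 'I_n -> H,
    forall x, exists! a : {ffun 'I_n -> R[i]}, x = \sum_(i < n) a i *: e i.

Definition diag_op (H1 H2 : hilbertType R) (N1 : operator H1 H1)
    (N2 : operator H2 H2) : operator (hsum H1 H2) (hsum H1 H2) :=
  Operator [set x | dom N1 x.1 /\ dom N2 x.2] (fun x => (N1 x.1, N2 x.2)).

(* The block matrix with diagonal [0, 0], upper right entry [C2] and lower left
   entry [C1]. *)
Definition antidiag (H1 H2 : hilbertType R) (C1 : H1 -> H2) (C2 : H2 -> H1)
    (x : hsum H1 H2) : hsum H1 H2 := (C2 x.2, C1 x.1).

Definition model_data (H1 H2 : hilbertType R) (N1 : operator H1 H1)
    (N2 : operator H2 H2) (C1 : H1 -> H2) (C2 : H2 -> H1) : Prop :=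
  [/\ normal_op N1, normal_op N2, conjugation (antidiag C1 C2) &
      op_eq (op_comp (diag_op N1 N2) (total_op (antidiag C1 C2)))
            (op_comp (total_op (antidiag C1 C2)) (diag_op N1 N2))].

Definition model_op (H1 H2 : hilbertType R) (N1 : operator H1 H1)
    (N2 : operator H2 H2) (C1 : H1 -> H2) (C2 : H2 -> H1) :
    operator (hsum H1 H2) (hsum H1 H2) :=
  op_comp (diag_op N1 N2) (total_op (antidiag C1 C2)).

Definition Tz_fun (z : R[i]) (x : hsum (Chilbert R) (Chilbert R)) :
    hsum (Chilbert R) (Chilbert R) :=
  (z^* * (x.2 : R[i])^*, z * (x.1 : R[i])^*).

Definition Tz (z : R[i]) := total_op (Tz_fun z).

(* The principal argument, in ]-pi, pi]; see [carg_itv] and [carg_polar]. *)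
Definition carg (z : R[i]) : R :=
  let t := acos (complex.Re z / complex.Re `|z|) in
  if 0 <= complex.Im z then t else - t.

Lemma carg_aux (z : R[i]) : z != 0 ->
  let r := complex.Re `|z| in let c := complex.Re z / r in
  [/\ 0 < r, `|z| = r%:C, r ^+ 2 = complex.Re z ^+ 2 + complex.Im z ^+ 2 &
      -1 <= c <= 1].
Proof.
move=> z0 r c.
have zE : `|z| = r%:C by rewrite /r; case: (z) => a b; rewrite normc_def.
have r0 : 0 < r by rewrite -ltcR -zE normr_gt0.
have r2 : r ^+ 2 = complex.Re z ^+ 2 + complex.Im z ^+ 2.
  by rewrite /r; case: (z) => a b; rewrite normc_def /= sqr_sqrtr // addr_ge0 ?sqr_ge0.
split=> //.
rewrite -ler_norml normrM normfV (gtr0_norm r0) ler_pdivrMr // mul1r.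
by rewrite -lecR -zE normr_Re.
Qed.

Lemma carg_itv (z : R[i]) : z != 0 -> - pi < carg z <= pi.
Proof.
move=> z0; have [r0 zE r2 cle] := carg_aux z0.
rewrite /carg; set c := _ / _.
have p0 : 0 < pi :> R := pi_gt0 R.
have t0 : 0 <= acos c by exact: acos_ge0.
have tpi : acos c <= pi by exact: acos_lepi.
case: ifPn => [_|]; first by rewrite tpi andbT; lra.
rewrite -ltNge => Im0; apply/andP; split; last by lra.
rewrite ltrN2 lt_neqAle tpi andbT; apply/eqP => tE.
have := acosK cle; rewrite tE cospi => cE.
have ReE : complex.Re z = - complex.Re `|z|.
  by rewrite -mulN1r cE /c divfK // gt_eqF.
by move: r2; rewrite ReE sqrrN => /eqP; rewrite -subr_eq0; nra.
Qed.

Lemma carg_polar (z : R[i]) : z != 0 ->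
  z = `|z| * (cos (carg z) +i* sin (carg z)).
Proof.
move=> z0; have [r0 zE r2 cle] := carg_aux z0; rewrite {1}zE /carg.
set r := complex.Re `|z| in r0 r2 cle zE *; set c := _ / _ in cle *.
have rn0 : r != 0 by rewrite gt_eqF.
have cosE : r * cos (acos c) = complex.Re z.
  by rewrite acosK // /c mulrC divfK.
have sinE : r * sin (acos c) = `|complex.Im z|.
  rewrite sin_acos // -(gtr0_norm r0) -sqrtr_sqr -sqrtrM ?sqr_ge0 //.
  rewrite -(sqrtr_sqr (complex.Im z)); congr Num.sqrt.
  by rewrite mulrBr mulr1 /c -exprMn mulrCA mulfV // mulr1 r2; ring.
case: ifPn => [Im0|].
  move: sinE; rewrite ger0_norm // => sinE.
  rewrite -(mulr1 r); apply/eqP; rewrite eq_complex /=.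
  by apply/andP; split; apply/eqP; rewrite -?cosE -?sinE /=; ring.
rewrite -ltNge => Im0; move: sinE; rewrite ltr0_norm // => sinE.
apply/eqP; rewrite eq_complex /= cosN sinN.
apply/andP; split; apply/eqP; rewrite ?cosE; first by rewrite -cosE; ring.
by rewrite -[LHS]opprK -sinE; ring.
Qed.

End operators.

(* Main.v *)
(* The conjugation makes [N2] the copy [C1 N1 C2] of [N1], so an orthogonal
   projection [P] commuting with [N1] yields the projection [P (+) C1 P C2]
   commuting with [T]: if [T] is irreducible, [N1] has no reducing subspace.
   Such a normal operator is scalar, and this needs no spectral theorem. Let [A]
   be a bounded self-adjoint operator commuting with it, and let [|A|] be the
   square root of [A^2], obtained by iteration. The kernel of [|A| + A] is a
   reducing subspace, so [A] is semidefinite; applied to all [A - c], this makes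
   [A] scalar. Taking [A = (1 + N1^* N1)^-1] shows that [N1] is bounded, and
   taking its real and imaginary parts shows that it is scalar; then every line
   reduces it, so [dim H1 = 1]. In dimension one [T] is [T_z] in the coordinates
   given by unit vectors [e] and [C1 e], where [z] can be replaced by [-z] (change
   the sign of one coordinate) and by its conjugate (swap the coordinates); a real
   [z] is excluded because the line spanned by [(e, C1 e)] reduces [T]. *)

Require Import Defs.
From HB Require Import structures.
From mathcomp Require Import all_boot all_order all_algebra.
From mathcomp Require Import all_classical all_reals all_analysis.
From mathcomp Require Import complex ring lra.

Set Implicit Arguments.
Unset Strict Implicit.
Unset Printing Implicit Defensive.

Import Order.TTheory GRing.Theory Num.Theory numFieldNormedType.Exports.
Local Open Scope classical_set_scope.
Local Open Scope complex_scope.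
Local Open Scope ring_scope.

(** * Real-valued norm and inner product *)

Section inner_product.
Variables (R : realType) (H : hilbertType R).
Implicit Types x y z u v : H.

Lemma dotDl x y z : dot (x + y) z = dot x z + dot y z.
Proof. exact: linearDl. Qed.

Lemma dotDr x y z : dot x (y + z) = dot x y + dot x z.
Proof. exact: linearDr. Qed.

Lemma dotBl x y z : dot (x - y) z = dot x z - dot y z.
Proof. exact: linearBl. Qed.

Lemma dotBr x y z : dot x (y - z) = dot x y - dot x z.
Proof. exact: linearBr. Qed.

Lemma dotNl x y : dot (- x) y = - dot x y.
Proof. exact: linearNl. Qed.

Lemma dotZl (a : R[i]) x y : dot (a *: x) y = a * dot x y.
Proof. exact: linearZl_LR. Qed.

Lemma dotZr (a : R[i]) x y : dot x (a *: y) = a^* * dot x y.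
Proof. by rewrite linearZr_LR. Qed.

Lemma dot0l x : dot 0 x = 0.
Proof. exact: linear0l. Qed.

Lemma dot0r x : dot x 0 = 0.
Proof. exact: linear0r. Qed.

Lemma dot_conj x y : dot x y = (dot y x)^*.
Proof. by rewrite (hermitian_subproof x y) expr0 mul1r. Qed.

Lemma dotxx_eq0 x : dot x x = 0 -> x = 0.
Proof. by rewrite dotxx => /eqP; rewrite expf_eq0 normr_eq0 => /eqP. Qed.

Lemma dot_eq x y : (forall z, dot x z = dot y z) -> x = y.
Proof.
move=> xy; apply/eqP; rewrite -subr_eq0; apply/eqP/dotxx_eq0.
by rewrite dotBl xy subrr.
Qed.

Definition rnorm x : R := complex.Re `|x|.

Lemma rnormE x : `|x| = (rnorm x)%:C.
Proof. by rewrite /rnorm RRe_real. Qed.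

Lemma rnorm_ge0 x : 0 <= rnorm x.
Proof. by rewrite -ler0c -rnormE. Qed.

Lemma rnorm0 : rnorm 0 = 0.
Proof. by rewrite /rnorm normr0. Qed.

Lemma rnorm0_eq0 x : rnorm x = 0 -> x = 0.
Proof. by move=> x0; apply/eqP; rewrite -normr_eq0 rnormE x0. Qed.

Lemma rnorm_gt0 x : x != 0 -> 0 < rnorm x.
Proof. by move=> x0; rewrite -ltcR -rnormE normr_gt0. Qed.

Lemma rnormN x : rnorm (- x) = rnorm x.
Proof. by rewrite /rnorm normrN. Qed.

Lemma rnormB x y : rnorm (x - y) = rnorm (y - x).
Proof. by rewrite -rnormN opprB. Qed.

Lemma rnormD x y : rnorm (x + y) <= rnorm x + rnorm y.
Proof. by rewrite -lecR raddfD /= -!rnormE ler_normD. Qed.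

Lemma rnormZ (a : R[i]) x : rnorm (a *: x) = complex.Re `|a| * rnorm x.
Proof.
apply: complexI.
by rewrite rmorphM /= -rnormE normrZ rnormE (RRe_real (normr_real _)).
Qed.

Lemma rnormZr (c : R) x : rnorm (c%:C *: x) = `|c| * rnorm x.
Proof. by rewrite rnormZ normc_def /= expr0n addr0 sqrtr_sqr. Qed.

Definition rdot x y : R := complex.Re (dot x y).

Lemma rdotDl x y z : rdot (x + y) z = rdot x z + rdot y z.
Proof. by rewrite /rdot dotDl raddfD. Qed.

Lemma rdotC x y : rdot x y = rdot y x.
Proof. by rewrite /rdot dot_conj; case: (dot y x). Qed.

Lemma rdotDr x y z : rdot x (y + z) = rdot x y + rdot x z.
Proof. by rewrite rdotC rdotDl !(rdotC x). Qed.

Lemma rdotZl (c : R) x y : rdot (c%:C *: x) y = c * rdot x y.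
Proof. rewrite /rdot dotZl; case: (dot x y) => a b /=; ring. Qed.

Lemma rdotZr (c : R) x y : rdot x (c%:C *: y) = c * rdot x y.
Proof. by rewrite rdotC rdotZl rdotC. Qed.

Lemma rdotNl x y : rdot (- x) y = - rdot x y.
Proof. by rewrite /rdot dotNl raddfN. Qed.

Lemma rdotNr x y : rdot x (- y) = - rdot x y.
Proof. by rewrite rdotC rdotNl rdotC. Qed.

Lemma rdot0l x : rdot 0 x = 0.
Proof. by rewrite /rdot dot0l. Qed.

Definition rdotE := (rdotDl, rdotDr, rdotNl, rdotNr, rdotZl, rdotZr).

Lemma rdotxx x : rdot x x = rnorm x ^+ 2.
Proof. by rewrite /rdot dotxx rnormE -rmorphXn. Qed.

Lemma dotxx_rnorm x : dot x x = (rnorm x ^+ 2)%:C.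
Proof. by rewrite dotxx rnormE -rmorphXn. Qed.

(** Cauchy-Schwarz: the square norm of [|y| x - |x| y] is nonnegative, and its expansion is
    divisible by [|x| |y|]. *)
Lemma rdot_le x y : rdot x y <= rnorm x * rnorm y.
Proof.
have [->|x0] := eqVneq x 0; first by rewrite rdot0l mulr_ge0 ?rnorm_ge0.
have [->|y0] := eqVneq y 0.
  by rewrite rdotC rdot0l mulr_ge0 ?rnorm_ge0.
have := exprn_ge0 2 (rnorm_ge0 ((rnorm y)%:C *: x - (rnorm x)%:C *: y)).
rewrite -rdotxx !rdotE !rdotxx (rdotC y).
have : 0 < rnorm x * rnorm y by rewrite mulr_gt0 ?rnorm_gt0.
by nra.
Qed.

(** The second argument is conjugate-linear, so pairing with ['i *: y] exposes the imaginary part.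
    Identities proved for [rdot], for instance by a limit, can thus be lifted to [dot]. *)
Lemma dot_rdot x y : dot x y = (rdot x y)%:C + 'i * (rdot x ('i *: y))%:C.
Proof.
rewrite /rdot dotZr; case: (dot x y) => a b; apply/eqP.
rewrite eq_complex /=; apply/andP; split; apply/eqP; ring.
Qed.

End inner_product.

(** * Limits and orthogonal projections *)

Section limits.
Variables (R : realType) (H : hilbertType R).
Implicit Types (x y l m : H) (u v : nat -> H).

(** Positive elements of [R[i]] are real, so real radii suffice. *)
Lemma rcvgP u l :
  (u @ \oo --> l) <->
  (forall e : R, 0 < e -> exists n, forall k, (n <= k)%N -> rnorm (l - u k) < e).
Proof.
split=> [/cvgrPdist_lt ul e e0|ul].
  have e0' : 0 < e%:C :> R[i] by rewrite ltcR.
  have [n _ nP] := ul _ e0'; exists n => k nk.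
  by rewrite -ltcR -rnormE; exact: nP.
apply/cvgrPdist_lt => e e0.
have eE : e = (complex.Re e)%:C by rewrite RRe_real // ger0_real // ltW.
have [|n nP] := ul (complex.Re e); first by rewrite -ltcR -eE.
by exists n => // k /= nk; rewrite eE rnormE ltcR nP.
Qed.

Lemma rcauchy_cvg u :
  (forall e : R, 0 < e -> exists n, forall j k, (n <= j)%N -> (n <= k)%N ->
     rnorm (u j - u k) < e) ->
  exists l, u @ \oo --> l.
Proof.
move=> uc; suff /cvg_ex [l ul] : cvg (u @ \oo) by exists l.
apply/cauchy_cvgP/cauchy_ballP => e e0; rewrite near_map2 /=.
have eE : e = (complex.Re e)%:C by rewrite RRe_real // ger0_real // ltW.
have [|n nP] := uc (complex.Re e); first by rewrite -ltcR -eE.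
exists ([set k | (n <= k)%N], [set k | (n <= k)%N]).
  by split; exists n.
by move=> [j k] [/= nj nk]; rewrite -ball_normE /= eE rnormE ltcR nP.
Qed.

Lemma rcvg_unique u l m : u @ \oo --> l -> u @ \oo --> m -> l = m.
Proof. exact: cvg_unique. Qed.

Lemma cvg_nonexpansive (f : H -> H) u l :
  (forall x y, rnorm (f x - f y) <= rnorm (x - y)) ->
  u @ \oo --> l -> f \o u @ \oo --> f l.
Proof.
move=> fle /rcvgP ul; apply/rcvgP => e /ul [n nP].
by exists n => k /nP; exact: le_lt_trans (fle _ _).
Qed.

Lemma rcvg_shift u l : u @ \oo --> l -> (fun n => u n.+1) @ \oo --> l.
Proof. by move=> ul; rewrite cvg_shiftS. Qed.

Lemma rcvg_rnorm_le u l (c : R) :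
  u @ \oo --> l -> (forall n, rnorm (u n) <= c) -> rnorm l <= c.
Proof.
move=> /rcvgP ul uc; apply/ler_addgt0Pr => e /ul [n /(_ n (leqnn n)) lt].
have -> : l = u n + (l - u n) by rewrite addrC subrK.
by rewrite (le_trans (rnormD _ _)) // lerD // ltW.
Qed.

(** By Cauchy-Schwarz, errors below [e / c] in both sequences cost at most
    [e / c * (rnorm x + rnorm y)], and [c] exceeds that sum of norms. *)
Lemma rcvg_rdot_eq u v l m (x y : H) :
  u @ \oo --> l -> v @ \oo --> m -> (forall n, rdot (u n) x = rdot (v n) y) ->
  rdot l x = rdot m y.
Proof.
move=> /rcvgP ul /rcvgP vm uv.
suff : `|rdot l x - rdot m y| <= 0 by rewrite normr_le0 subr_eq0 => /eqP.
apply/ler_addgt0Pr => e e0; rewrite add0r.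
set c := rnorm x + rnorm y + 1.
have x0 := rnorm_ge0 x; have y0 := rnorm_ge0 y.
have c0 : 0 < c by rewrite /c; lra.
have d0 : 0 < e / c by rewrite divr_gt0.
have [n nP] := ul _ d0; have [p pP] := vm _ d0.
set k := maxn n p.
have {}nP := nP k (leq_maxl _ _); have {}pP := pP k (leq_maxr _ _).
have -> : rdot l x - rdot m y = rdot (l - u k) x - rdot (m - v k) y.
  by rewrite !rdotE uv; ring.
have -> : e = e / c * c by rewrite divfK // gt_eqF.
have := rdot_le (l - u k) x; have := rdot_le (m - v k) y.
have := rdot_le (- (l - u k)) x; have := rdot_le (- (m - v k)) y.
rewrite !rdotNl !rnormN ler_norml.
have := rnorm_ge0 (l - u k); have := rnorm_ge0 (m - v k).
set p1 := rnorm (l - u k) in nP *; set p2 := rnorm (m - v k) in pP *.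
move: nP pP; rewrite {2}/c; set d := e / c => nP pP p20 p10 h1 h2 h3 h4.
have : p1 * rnorm x <= d * rnorm x by rewrite ler_wpM2r // ltW.
have : p2 * rnorm y <= d * rnorm y by rewrite ler_wpM2r // ltW.
by rewrite /c => ? ?; apply/andP; split; nra.
Qed.

Lemma parallelogram x y :
  rnorm (x + y) ^+ 2 + rnorm (x - y) ^+ 2 = 2 * rnorm x ^+ 2 + 2 * rnorm y ^+ 2.
Proof. by rewrite -!rdotxx !rdotE (rdotC y); ring. Qed.

Lemma rnorm_sub_proj x y : y != 0 ->
  (rnorm (x - (dot x y / (rnorm y ^+ 2)%:C) *: y) ^+ 2)%:C =
  (rnorm x ^+ 2)%:C - `|dot x y| ^+ 2 / (rnorm y ^+ 2)%:C :> R[i].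
Proof.
move=> y0; rewrite -dotxx_rnorm.
rewrite dotBl !dotBr !dotZl !dotZr !dotxx_rnorm (dot_conj y x) normCK.
have : rnorm y ^+ 2 != 0 by rewrite gt_eqF // exprn_gt0 // rnorm_gt0.
move: (rnorm y ^+ 2) (rnorm x ^+ 2) (dot x y) => r s w r0.
have -> : (w / r%:C)^* = w^* / r%:C by rewrite fmorph_div /= [X in _ / X]conjc_real.
have : r%:C != 0 :> R[i] by rewrite fmorph_eq0.
by move=> ?; field.
Qed.

(** A minimising sequence for the distance to [G] is Cauchy, and its limit is the foot of the
    perpendicular. Closedness is sequential, the form available for the graph of an operator. *)
Lemma orthogonal_projection (G : set H) (x : H) :
  G 0 -> (forall (a : R[i]) y z, G y -> G z -> G (a *: y + z)) ->
  (forall u l, (forall n, G (u n)) -> u @ \oo --> l -> G l) ->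
  exists2 g, G g & forall y, G y -> dot (x - g) y = 0.
Proof.
move=> G0 Glin Gclosed.
pose D : set R := [set d | exists2 g, G g & d = rnorm (x - g)].
have D0 : D !=set0 by exists (rnorm (x - 0)), 0.
have Dlb : lbound D 0 by move=> _ [g _ ->]; exact: rnorm_ge0.
have Dinf : has_inf D by split => //; exists 0.
set d := inf D.
have d0 : 0 <= d by exact: lb_le_inf.
have dle g : G g -> d <= rnorm (x - g).
  by move=> Gg; apply: ge_inf; [exists 0|exists g].
have /choice [u uP] (n : nat) : exists g, G g /\ rnorm (x - g) < d + n.+1%:R^-1.
  have [|_ [g Gg ->] lt] := @inf_adherent _ D n.+1%:R^-1 _ Dinf.
    by rewrite invr_gt0.
  by exists g.
have uG n : G (u n) by case: (uP n).
have Ghalf y z : G y -> G z -> G ((2^-1 : R)%:C *: (y + z)).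
  move=> Gy Gz; rewrite -[X in G X]addr0; apply: (Glin) => //.
  by rewrite -[y]scale1r; exact: Glin.
(* The midpoint of [u j] and [u k] is in [G], so at distance at least [d] from [x]; the
   parallelogram law leaves [4 (d + e)^2 - 4 d^2], at most [e (8 d + 4)] when [e <= 1]. *)
have udist j k e : 0 < e -> e <= 1 -> rnorm (x - u j) < d + e ->
    rnorm (x - u k) < d + e -> rnorm (u j - u k) ^+ 2 <= e * (8 * d + 4).
  move=> e0 e1 je ke.
  have := dle _ (Ghalf _ _ (uG j) (uG k)).
  have := parallelogram (x - u j) (x - u k).
  have -> : x - u j - (x - u k) = - (u j - u k).
    by rewrite opprB [RHS]opprB addrC addrA subrK.
  rewrite rnormN.
  have -> : x - u j + (x - u k) = (2 : R)%:C *: (x - (2^-1 : R)%:C *: (u j + u k)).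
    rewrite scalerBr scalerA -rmorphM mulfV ?pnatr_eq0 // rmorph1 scale1r.
    by rewrite rmorph_nat scaler_nat mulr2n opprD addrACA.
  rewrite rnormZr ger0_norm // => pE dz.
  set p := rnorm (x - u j) in je pE; set q := rnorm (x - u k) in ke pE.
  have p0 : 0 <= p by exact: rnorm_ge0.
  have q0 : 0 <= q by exact: rnorm_ge0.
  set r := rnorm (x - _) in pE dz; set s := rnorm _ in pE *.
  have : p ^+ 2 <= (d + e) ^+ 2 by rewrite ler_pXn2r ?nnegrE // ?ltW //; lra.
  have : q ^+ 2 <= (d + e) ^+ 2 by rewrite ler_pXn2r ?nnegrE // ?ltW //; lra.
  have : d ^+ 2 <= r ^+ 2 by rewrite ler_pXn2r ?nnegrE //; lra.
  have : e ^+ 2 <= e by rewrite expr2 ler_piMl // ltW.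
  have -> : s ^+ 2 = 2 * p ^+ 2 + 2 * q ^+ 2 - 4 * r ^+ 2.
    by rewrite -pE; ring.
  move=> *; nra.
have [l ul] : exists l, u @ \oo --> l.
  apply: rcauchy_cvg => e e0.
  have c0 : 0 < e ^+ 2 / (8 * d + 5) by rewrite divr_gt0 ?exprn_gt0 //; lra.
  have [n nP] : exists n, n.+1%:R^-1 < e ^+ 2 / (8 * d + 5).
    exists (Num.truncn (e ^+ 2 / (8 * d + 5))^-1).
    rewrite invf_plt ?posrE //.
    exact: truncnS_gt.
  have close k : (n <= k)%N -> rnorm (x - u k) < d + n.+1%:R^-1.
    move=> nk; apply: lt_le_trans (proj2 (uP k)) _.
    by rewrite lerD2l lef_pV2 ?posrE // ler_nat ltnS.
  exists n => j k nj nk.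
  have n1 : 0 < n.+1%:R^-1 :> R by rewrite invr_gt0.
  have := udist j k _ n1 _ (close _ nj) (close _ nk).
  rewrite invf_le1 // ler1n => /(_ isT) le.
  rewrite -(@ltr_pXn2r _ 2) ?nnegrE ?rnorm_ge0 // ?ltW //.
  apply: le_lt_trans le _.
  have d5 : 0 < 8 * d + 5 by lra.
  move: nP; rewrite ltr_pdivlMr //; apply: le_lt_trans.
  by rewrite ler_wpM2l ?ltW // ltrD2l ltr_nat.
have Gl : G l by exact: Gclosed ul.
have dl : rnorm (x - l) <= d.
  apply/ler_addgt0Pr => e e0.
  have e2 : 0 < e / 2 by rewrite divr_gt0.
  move/rcvgP : ul => /(_ _ e2) [n nP].
  pose k := maxn n (Num.truncn (e / 2)^-1).
  have := nP k (leq_maxl _ _).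
  have : rnorm (x - u k) < d + e / 2.
    apply: lt_le_trans (proj2 (uP k)) _.
    rewrite lerD2l invf_ple ?posrE // (le_trans (ltW (truncnS_gt _))) //.
    by rewrite ler_nat ltnS leq_maxr.
  have -> : x - l = (x - u k) - (l - u k) by rewrite opprB addrA subrK.
  have := rnormD (x - u k) (- (l - u k)); rewrite rnormN.
  by move=> *; lra.
exists l => // y Gy.
have [->|y0] := eqVneq y 0; first by rewrite dot0r.
set z := x - l.
pose c : R[i] := dot z y / (rnorm y ^+ 2)%:C.
have yn0 : 0 < rnorm y by exact: rnorm_gt0.
(* Removing the component of [z] along [y] lowers the square norm by [|dot z y|^2 / |y|^2], but no
   point of [G] is closer than [d]. *)
have : d <= rnorm (z - c *: y).
  have -> : z - c *: y = x - (c *: y + l) by rewrite /z opprD addrA addrAC.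
  by apply: dle; exact: Glin.
have zyE := rnorm_sub_proj z y0; rewrite -/c in zyE.
move=> dle'.
suff : `|dot z y| ^+ 2 <= 0.
  move=> le0; apply/eqP; rewrite -normr_eq0 -sqrf_eq0 eq_le le0 /=.
  exact: exprn_ge0.
suff : `|dot z y| ^+ 2 / (rnorm y ^+ 2)%:C <= 0.
  by rewrite pmulr_lle0 // invr_gt0 ltcR exprn_gt0.
have -> : `|dot z y| ^+ 2 / (rnorm y ^+ 2)%:C =
    (rnorm z ^+ 2 - rnorm (z - c *: y) ^+ 2)%:C.
  by rewrite rmorphB /= zyE opprB addrC subrK.
rewrite lecR subr_le0 ler_pXn2r ?nnegrE ?rnorm_ge0 //.
exact: le_trans dl dle'.
Qed.

End limits.

(** * Symmetric contractions *)

Section symmetric_contractions.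
Variables (R : realType) (H : hilbertType R).
Implicit Types (x y z l : H) (P Q D E : H -> H) (N : operator H H).

Definition sym_contraction Q : Prop :=
  (forall x y, dot (Q x) y = dot x (Q y)) /\ (forall x, rnorm (Q x) <= rnorm x).

Definition commutes N Q : Prop :=
  forall x, dom N x -> dom N (Q x) /\ N (Q x) = Q (N x).

Definition seq_closed N : Prop := forall (u : nat -> H) l m,
  (forall n, dom N (u n)) -> u @ \oo --> l -> (fun n => N (u n)) @ \oo --> m ->
  dom N l /\ N l = m.

Lemma sc_sym Q x y : sym_contraction Q -> dot (Q x) y = dot x (Q y).
Proof. by case. Qed.

Lemma sc_rdot Q x y : sym_contraction Q -> rdot (Q x) y = rdot x (Q y).
Proof. by case=> Qs _; rewrite /rdot Qs. Qed.

(** Symmetry forces linearity: pair both sides with an arbitrary [z] and move [Q] over to it. *)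
Lemma sc_linear Q (a b : R[i]) x y : sym_contraction Q ->
  Q (a *: x + b *: y) = a *: Q x + b *: Q y.
Proof.
move=> [Qs _]; apply: dot_eq => z.
by rewrite Qs !dotDl !dotZl !Qs.
Qed.

Lemma sc0 Q : sym_contraction Q -> Q 0 = 0.
Proof.
by move=> Qsc; have := sc_linear 0 0 0 0 Qsc; rewrite !scale0r !addr0.
Qed.

Lemma scD Q x y : sym_contraction Q -> Q (x + y) = Q x + Q y.
Proof. by move=> /(sc_linear 1 1 x y); rewrite !scale1r. Qed.

Lemma scZ Q (a : R[i]) x : sym_contraction Q -> Q (a *: x) = a *: Q x.
Proof. by move=> /(sc_linear a 0 x 0); rewrite !scale0r !addr0. Qed.

Lemma scN Q x : sym_contraction Q -> Q (- x) = - Q x.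
Proof. by move=> Qsc; rewrite -scaleN1r scZ // scaleN1r. Qed.

Lemma scB Q x y : sym_contraction Q -> Q (x - y) = Q x - Q y.
Proof. by move=> Qsc; rewrite scD // scN. Qed.

Lemma sc_nonexpansive Q x y : sym_contraction Q ->
  rnorm (Q x - Q y) <= rnorm (x - y).
Proof. by move=> Qsc; rewrite -scB //; case: Qsc. Qed.

Lemma sc_id : sym_contraction (@id H).
Proof. by []. Qed.

Lemma sc_zero : sym_contraction (fun=> 0 : H).
Proof.
by split=> [x y|x]; [rewrite dot0l dot0r|rewrite rnorm0 rnorm_ge0].
Qed.

Lemma sc_comp P Q : sym_contraction P -> sym_contraction Q ->
  (forall x, P (Q x) = Q (P x)) -> sym_contraction (P \o Q).
Proof.
move=> [Ps Pc] [Qs Qc] PQ; split=> [x y|x] /=; first by rewrite Ps Qs PQ.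
exact: le_trans (Pc _) (Qc _).
Qed.

Lemma sc_comb (a b : R) P Q : `|a| + `|b| <= 1 ->
  sym_contraction P -> sym_contraction Q ->
  sym_contraction (fun x => a%:C *: P x + b%:C *: Q x).
Proof.
move=> ab [Ps Pc] [Qs Qc]; split=> [x y|x].
  by rewrite dotDl dotDr !dotZl !dotZr Ps Qs ![X in _ = X * _ + _]conjc_real
    ![X in _ = _ + X * _]conjc_real.
rewrite (le_trans (rnormD _ _)) // !rnormZr -[leRHS]mul1r.
rewrite (le_trans _ (ler_wpM2r (rnorm_ge0 x) ab)) // mulrDl.
by rewrite lerD // ler_wpM2l.
Qed.

(** The square norm expands to [|x|^2 - 2 |Q x|^2 + |Q (Q x)|^2], whose last term is at most
    [|Q x|^2]. The gain [|Q x|^2] later identifies the kernel of [Q]. *)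
Lemma sc_compl_sqr Q : sym_contraction Q ->
  (forall x, rnorm (x - Q (Q x)) ^+ 2 <= rnorm x ^+ 2 - rnorm (Q x) ^+ 2) /\
  sym_contraction (fun x => x - Q (Q x)).
Proof.
move=> Qsc; have [Qs Qc] := Qsc.
have le x : rnorm (x - Q (Q x)) ^+ 2 <= rnorm x ^+ 2 - rnorm (Q x) ^+ 2.
  rewrite -rdotxx !rdotE (rdotC (Q (Q x)) x) -(sc_rdot x (Q x) Qsc) !rdotxx.
  suff : rnorm (Q (Q x)) ^+ 2 <= rnorm (Q x) ^+ 2 by lra.
  by rewrite ler_pXn2r ?nnegrE ?rnorm_ge0.
split=> //; split=> [x y|x]; first by rewrite dotBl dotBr !Qs.
rewrite -(@ler_pXn2r _ 2) ?nnegrE ?rnorm_ge0 //.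
by rewrite (le_trans (le x)) // gerBl exprn_ge0 ?rnorm_ge0.
Qed.

Lemma sc_lim (Qs : nat -> H -> H) Q : (forall n, sym_contraction (Qs n)) ->
  (forall x, (fun n => Qs n x) @ \oo --> Q x) -> sym_contraction Q.
Proof.
move=> sc lim; split=> [x y|x]; last first.
  by apply: rcvg_rnorm_le (lim x) _ => n; case: (sc n).
have rs u v : rdot (Q u) v = rdot u (Q v).
  rewrite (rdotC u); apply: rcvg_rdot_eq (lim u) (lim v) _ => n.
  by rewrite (sc_rdot u v (sc n)) rdotC.
(* Symmetry passes to the limit only for real parts; commutation with ['i] then recovers the
   imaginary part. *)
have iQ : Q ('i *: y) = 'i *: Q y.
  apply: rcvg_unique (lim _) _.
  rewrite [X in X @ _](_ : _ = fun n => 'i *: Qs n y).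
    exact: cvgZr (lim y).
  by apply/funext => n; rewrite scZ.
by rewrite !dot_rdot rs rs iQ.
Qed.

(** Closedness of [N] carries the limit through an operator that may be unbounded. *)
Lemma commutes_lim N (Qs : nat -> H -> H) Q : seq_closed N ->
  (forall n, commutes N (Qs n)) ->
  (forall x, (fun n => Qs n x) @ \oo --> Q x) -> commutes N Q.
Proof.
move=> Ncl com lim x Nx; apply: Ncl (lim x) _ => [n|].
  by have [] := com n x Nx.
rewrite [X in X @ _](_ : _ = fun n => Qs n (N x)); first exact: lim.
by apply/funext => n; have [] := com n x Nx.
Qed.

Lemma commutes_comp N P Q : commutes N P -> commutes N Q -> commutes N (P \o Q).
Proof.
move=> NP NQ x Nx; have [Qx NQx] := NQ x Nx.
by have [PQx NPQx] := NP _ Qx; split=> //=; rewrite NPQx NQx.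
Qed.

Lemma commutes_comb N (a b : R[i]) P Q : linear_op N ->
  commutes N P -> commutes N Q -> commutes N (fun x => a *: P x + b *: Q x).
Proof.
move=> [_ Nlin] NP NQ x Nx; have [Px NPx] := NP x Nx; have [Qx NQx] := NQ x Nx.
by have [? ->] := Nlin a b _ _ Px Qx; split=> //; rewrite NPx NQx.
Qed.

Lemma commutes_id N : commutes N id.
Proof. by []. Qed.

Lemma commutes_zero N : linear_op N -> commutes N (fun=> 0).
Proof.
move=> [N0 Nlin] x Nx; split=> //=.
by have [_] := Nlin 0 0 _ _ N0 N0; rewrite !scale0r addr0.
Qed.

Lemma commutes_compl_sqr N Q : linear_op N -> commutes N Q ->
  commutes N (fun x => x - Q (Q x)).
Proof.
move=> Nlin NQ.
have := commutes_comb 1 (-1) Nlin (@commutes_id N) (commutes_comp NQ NQ).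
by congr commutes; apply/funext => x /=; rewrite scale1r scaleN1r.
Qed.

Lemma linear_total_op Q : sym_contraction Q -> linear_op (total_op Q).
Proof. by move=> Qsc; split=> // a b x y _ _; split=> //=; exact: sc_linear. Qed.

Lemma seq_closed_total_op Q : sym_contraction Q -> seq_closed (total_op Q).
Proof.
move=> Qsc u l m _ ul Qul; split=> //=; apply: rcvg_unique _ Qul.
by apply: cvg_nonexpansive ul => x y; exact: sc_nonexpansive.
Qed.

(** The bounded monotone sequence [y] converges, and its increments control those of [u], which is
    therefore Cauchy. *)
Lemma rcvg_monotone (u : nat -> H) (y : nat -> R) (c M : R) : 0 <= c ->
  nondecreasing_seq y -> (forall n, y n <= M) ->
  (forall m n, (n <= m)%N -> rnorm (u m - u n) ^+ 2 <= c * (y m - y n)) ->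
  exists l : H, u @ \oo --> l.
Proof.
move=> c0 ynd yM uy; apply: rcauchy_cvg => e e0.
have ycvg : cvgn y.
  by apply: nondecreasing_is_cvgn => //; exists M => _ [n _ <-].
have yle := nondecreasing_cvgn_le ynd ycvg.
have d0 : 0 < e ^+ 2 / (c + 1) by rewrite divr_gt0 ?exprn_gt0 //; lra.
have [n _ nP] : \forall n \near \oo, `|limn y - y n| < e ^+ 2 / (c + 1).
  by move: ycvg => /cvgrPdist_lt; exact.
exists n.
have main j k : (n <= k)%N -> (k <= j)%N -> rnorm (u j - u k) < e.
  move=> nk kj; rewrite -(@ltr_pXn2r _ 2) ?nnegrE ?rnorm_ge0 // ?ltW //.
  apply: le_lt_trans (uy _ _ kj) _.
  have := nP _ nk; rewrite /= ger0_norm ?subr_ge0 ?yle //.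
  rewrite ltr_pdivlMr; last by lra.
  have := yle j; have := ynd _ _ kj; nra.
move=> j k nj nk; case: (leqP k j) => [|/ltnW] h; first exact: main.
by rewrite rnormB; exact: main.
Qed.

(** For [D = 1 - A^2] the equation says [(1 - Y)^2 = A^2], so [1 - Y] is the square root of [A^2].
    The iteration [Y := (D + Y^2) / 2] from [0] converges pointwise, and each iterate commutes with
    whatever commutes with [D]. *)
Lemma sc_fixpoint D : sym_contraction D ->
  exists Y : H -> H, [/\ sym_contraction Y,
    forall x, (2 : R)%:C *: Y x = D x + Y (Y x) &
    forall N, linear_op N -> seq_closed N -> commutes N D -> commutes N Y].
Proof.
move=> Dsc; have [_ Dc] := Dsc.
pose h : R := 2^-1.
pose Y := fix Y n := if n is m.+1 then
  fun x => h%:C *: D x + h%:C *: (Y m \o Y m) x else fun=> 0 : H.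
(* The same iteration with [D] replaced by [1]: it increases within [[0, 1]] and dominates the norms
   of the iterates and of their increments. *)
pose y := fix y n := if n is m.+1 then h * (1 + y m ^+ 2) else 0 : R.
have h0 : 0 < h by rewrite invr_gt0.
have hE : h = 2^-1 by [].
have Ysc n : sym_contraction (Y n).
  elim: n => [|n IH]; first exact: sc_zero.
  apply: sc_comb => //; first by rewrite (ger0_norm (ltW h0)) hE; lra.
  exact: sc_comp.
have y01 n : 0 <= y n <= 1.
  elim: n => [|n /andP[IH0 IH1]] /=; first by rewrite lexx ler01.
  have : y n ^+ 2 <= 1 by rewrite expr_le1.
  have := sqr_ge0 (y n); rewrite hE.
  by move: (y n ^+ 2) => w *; apply/andP; split; lra.
have yS n : y n <= y n.+1.
  have := sqr_ge0 (y n - 1); rewrite /= hE.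
  by move: (y n) => w; nra.
have ynd : nondecreasing_seq y by apply/nondecreasing_seqP.
have Yle n x : rnorm (Y n x) <= y n * rnorm x.
  elim: n x => [|n IH] x /=; first by rewrite rnorm0 mul0r.
  rewrite (le_trans (rnormD _ _)) // !rnormZr (ger0_norm (ltW h0)).
  have [/andP[yn0 _] x0] := (y01 n, rnorm_ge0 x).
  have := ler_wpM2l yn0 (IH x).
  by have := IH (Y n x); have := Dc x; nra.
have YS n x : rnorm (Y n.+1 x - Y n x) <= (y n.+1 - y n) * rnorm x.
  elim: n x => [|n IH] x.
    by rewrite [Y 0%N]/= [y 0%N]/= !subr0; exact: Yle.
  rewrite [Y n.+2]/= [Y n.+1 in X in _ - X]/= opprD addrACA subrr add0r.
  rewrite -scalerBr rnormZr (ger0_norm (ltW h0)).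
  (* With bounds [b] and [a] for the two iterates, this splitting gives
     [(b - a) b + a (b - a) = b^2 - a^2], matching the scalar increment. *)
  have -> : Y n.+1 (Y n.+1 x) - Y n (Y n x) =
      (Y n.+1 (Y n.+1 x) - Y n (Y n.+1 x)) + Y n (Y n.+1 x - Y n x).
    by rewrite scB // addrA subrK.
  have := rnormD (Y n.+1 (Y n.+1 x) - Y n (Y n.+1 x)) (Y n (Y n.+1 x - Y n x)).
  have := IH (Y n.+1 x); have := Yle n (Y n.+1 x - Y n x).
  have := IH x; have := Yle n.+1 x; have := y01 n; have := y01 n.+1.
  have := yS n; rewrite [y n.+2]/=.
  set a := y n; set b := y n.+1 => ab /andP[b0 b1] /andP[a0 a1].
  have := rnorm_ge0 x; set r := rnorm x.
  set p := rnorm (Y n.+1 x); set q := rnorm (Y n.+1 x - Y n x).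
  move=> r0 pb qb; set s := rnorm (Y n _); set t := rnorm (_ - _); set w := rnorm _.
  move=> sa ta wst.
  have b_a : 0 <= b - a by lra.
  have := ler_wpM2l a0 qb; have := ler_wpM2l b_a pb => h1 h2.
  have -> : (h * (1 + b ^+ 2) - h * (1 + a ^+ 2)) * r =
    h * ((b - a) * (b * r) + a * ((b - a) * r)) by ring.
  by rewrite ler_pM2l //; lra.
have Ydist m n x : (n <= m)%N -> rnorm (Y m x - Y n x) <= (y m - y n) * rnorm x.
  elim: m => [|m IH].
    by rewrite leqn0 => /eqP ->; rewrite !subrr mul0r rnorm0.
  rewrite leq_eqVlt => /orP[/eqP <-|]; first by rewrite !subrr mul0r rnorm0.
  rewrite ltnS => /IH le.
  have -> : Y m.+1 x - Y n x = (Y m.+1 x - Y m x) + (Y m x - Y n x).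
    by rewrite addrA subrK.
  rewrite (le_trans (rnormD _ _)) // (le_trans (lerD (YS m x) le)) //.
  by rewrite -mulrDl addrA subrK.
have /choice [Z Zlim] x : exists l : H, (fun n => Y n x) @ \oo --> l.
  apply: (@rcvg_monotone _ y (rnorm x ^+ 2) 1) => [|//|n|m n nm].
  - by rewrite exprn_ge0 ?rnorm_ge0.
  - by case/andP: (y01 n).
  have ymn : 0 <= y m - y n <= 1.
    have := ynd _ _ nm; have /andP[] := y01 n; have /andP[] := y01 m.
    by move=> *; apply/andP; split; lra.
  have /(le_trans _) : ((y m - y n) * rnorm x) ^+ 2 <= rnorm x ^+ 2 * (y m - y n).
    rewrite exprMn mulrC ler_wpM2l ?exprn_ge0 ?rnorm_ge0 //.
    by case/andP: ymn => ? ?; rewrite expr2 ler_piMl.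
  apply; rewrite ler_pXn2r ?nnegrE ?rnorm_ge0 ?mulr_ge0 ?rnorm_ge0 //.
    exact: Ydist.
  by case/andP: ymn.
have Zsc : sym_contraction Z by exact: sc_lim Zlim.
exists Z; split=> // [x|N Nlin Ncl ND].
  have lim1 : (fun n => (2 : R)%:C *: Y n.+1 x) @ \oo --> (2 : R)%:C *: Z x.
    by apply: cvgZr; exact: (rcvg_shift (Zlim x)).
  apply: rcvg_unique lim1 _.
  rewrite [X in X @ _](_ : _ = fun n => D x + Y n (Y n x)); last first.
    apply/funext => n /=; rewrite -scalerDr scalerA -rmorphM mulfV //.
    by rewrite rmorph1 scale1r.
  apply: cvgD; first exact: cvg_cst.
  (* Both the operator and its argument vary with [n]; the first summand tends to [0] because every
     [Y n] is a contraction. *)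
  rewrite [X in X @ _](_ : _ = (fun n => Y n (Y n x - Z x)) \+ fun n => Y n (Z x));
    last by apply/funext => n /=; rewrite scB // subrK.
  rewrite -[Z (Z x)]add0r; apply: cvgD; last exact: Zlim.
  apply/rcvgP => e e0; have /rcvgP/(_ _ e0) [n nP] := Zlim x.
  exists n => k /nP; apply: le_lt_trans.
  by rewrite sub0r rnormN rnormB; case: (Ysc k) => _ /(_ (Y k x - Z x)).
apply: commutes_lim Zlim => //; elim=> [|n IH]; first exact: commutes_zero.
by apply: commutes_comb => //; exact: commutes_comp.
Qed.

(** The projection on the kernel of [Q] is the pointwise limit of the powers of [V = (1 - Q^2)^2],
    whose fixed vectors are exactly that kernel. *)
Lemma kernel_projection Q : sym_contraction Q ->
  exists P : H -> H, [/\ sym_contraction P, forall x, P (P x) = P x,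
    forall x, P x = x <-> Q x = 0 &
    forall N, linear_op N -> seq_closed N -> commutes N Q -> commutes N P].
Proof.
move=> Qsc; have [Ele Esc] := sc_compl_sqr Qsc.
set E := fun x => x - Q (Q x) in Ele Esc.
pose V := E \o E.
have Vsc : sym_contraction V by exact: sc_comp.
have Vnsc n : sym_contraction (iter n V).
  elim: n => [|n IH]; first exact: sc_id.
  by apply: (sc_comp Vsc IH) => x; rewrite -iterS iterSr.
have iterV n x : iter n V x = iter n E (iter n E x).
  by elim: n => // n IH; rewrite iterS IH /V /= -[in RHS]iterSr.
have Ensc n : sym_contraction (iter n E).
  elim: n => [|n IH]; first exact: sc_id.
  by apply: (sc_comp Esc IH) => x; rewrite -iterS iterSr.
have Vdot m n x : rdot (iter m V x) (iter n V x) = rnorm (iter (m + n) E x) ^+ 2.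
  rewrite (sc_rdot _ _ (Vnsc m)) -iterD iterV -(sc_rdot _ _ (Ensc _)).
  exact: rdotxx.
have /choice [P Plim] x : exists l : H, (fun n => iter n V x) @ \oo --> l.
  (* As [V] is the square of [E], one gets [|V^m x - V^n x|^2 = b (2m) - 2 b (m + n) + b (2n)], at
     most [b (2n) - b (2m)] because [b] decreases. *)
  pose b n := rnorm (iter n E x) ^+ 2.
  have bS n : b n.+1 <= b n.
    rewrite /b ler_pXn2r ?nnegrE ?rnorm_ge0 // iterS.
    by case: Esc.
  have bni : nonincreasing_seq b by apply/nonincreasing_seqP.
  apply: (@rcvg_monotone _ (fun n => - b (n + n)%N) 1 0) => [//|m n mn|n|m n nm].
  - by rewrite lerN2 bni // leq_add.
  - by rewrite oppr_le0 exprn_ge0 ?rnorm_ge0.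
  rewrite -rdotxx !rdotE !Vdot mul1r opprK -/(b _) -/(b _) -/(b _) -/(b _).
  rewrite (addnC n m).
  have : b (m + m)%N <= b (m + n)%N by rewrite bni // leq_add2l.
  by lra.
have Psc : sym_contraction P by exact: sc_lim Plim.
have VP x : V (P x) = P x.
  have lim1 : V \o (fun n => iter n V x) @ \oo --> V (P x).
    apply: cvg_nonexpansive (Plim x) => u v; exact: sc_nonexpansive.
  by apply: rcvg_unique lim1 _; exact: (rcvg_shift (Plim x)).
have Pfix x : V x = x -> P x = x.
  move=> Vx; apply: rcvg_unique (Plim x) _.
  rewrite [X in X @ _](_ : _ = fun=> x); first exact: cvg_cst.
  by apply/funext; elim=> //= n ->.
exists P; split=> // [x|x|N Nlin Ncl NQ]; first exact/Pfix/VP.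
  split=> [Px|Qx]; last first.
    by apply: Pfix; rewrite /V /E /= Qx !(sc0 Qsc) !subr0 Qx (sc0 Qsc) subr0.
  apply: rnorm0_eq0; apply/eqP; rewrite -sqrf_eq0 eq_le sqr_ge0 andbT.
  have Vx : E (E x) = x by rewrite -Px; exact: VP.
  (* Here [|x| = |E (E x)| <= |E x|], so the sharp bound [|E x|^2 <= |x|^2 - |Q x|^2] leaves no room
     for [Q x]. *)
  have [_ /(_ (E x))] := Esc; rewrite Vx => le.
  have : rnorm x ^+ 2 <= rnorm (E x) ^+ 2 by rewrite ler_pXn2r ?nnegrE ?rnorm_ge0.
  by have := Ele x; rewrite -/(E x); lra.
have NE : commutes N E by exact: commutes_compl_sqr.
apply: commutes_lim Plim => //; elim=> [|n IH]; first exact: commutes_id.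
by apply: commutes_comp IH; exact: commutes_comp.
Qed.

End symmetric_contractions.

(** * Normal operators without reducing projections *)

Section irreducible_normal_operators.
Variables (R : realType) (H : hilbertType R).
Implicit Types (x y z l : H) (P Q A T : H -> H) (N : operator H H).

Lemma sc_idempotent P : (forall x y, dot (P x) y = dot x (P y)) ->
  (forall x, P (P x) = P x) -> sym_contraction P.
Proof.
move=> Ps PP; split=> // x.
have : rnorm (P x) ^+ 2 <= rnorm (P x) * rnorm x.
  by rewrite -rdotxx /rdot Ps PP -/(rdot x (P x)) mulrC rdot_le.
have := rnorm_ge0 (P x); rewrite le_eqVlt => /orP[/eqP <- _|p0].
  exact: rnorm_ge0.
by rewrite expr2 ler_pM2l.
Qed.

(** Polarisation: the form evaluated at [x + Q x] is [2 |Q x|^2]. *)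
Lemma sc_rdot_eq0 Q : sym_contraction Q -> (forall x, rdot (Q x) x = 0) ->
  forall x, Q x = 0.
Proof.
move=> Qsc Q0 x; apply: rnorm0_eq0; apply/eqP; rewrite -sqrf_eq0 -rdotxx.
have := Q0 (x + Q x); rewrite (scD _ _ Qsc) !rdotE !Q0.
by rewrite (sc_rdot (Q x) x Qsc) => ?; apply/eqP; lra.
Qed.

Definition no_reducing_projection N : Prop :=
  forall P, sym_contraction P -> (forall x, P (P x) = P x) -> commutes N P ->
    (forall x, P x = 0) \/ (forall x, P x = x).

Section no_reduction.
Variable N : operator H H.
Hypotheses (Nlin : linear_op N) (Ncl : seq_closed N).
Hypothesis Nirr : no_reducing_projection N.

(* With [M = |A|], one has [(M + A)(M - A) = 0], and [M + A] is either zero or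
   injective since its kernel is a reducing subspace. *)
Lemma definite_of_commutes A : sym_contraction A -> commutes N A ->
  (forall x, 0 <= rdot (A x) x) \/ (forall x, rdot (A x) x <= 0).
Proof.
move=> Asc NA; have [_ Dsc] := sc_compl_sqr Asc.
have [Y [Ysc YE Ycom]] := sc_fixpoint Dsc.
(* [A] itself, as an everywhere defined operator, is an admissible [N] in the commutation clause for
   [Y]. *)
have YA x : Y (A x) = A (Y x).
  have DA : commutes (total_op A) (fun x => x - A (A x)).
    by move=> u _; split=> //=; rewrite !(scB _ _ Asc).
  by have [] := Ycom _ (linear_total_op Asc) (seq_closed_total_op Asc) DA x I.
have NY : commutes N Y by apply: Ycom => //; exact: commutes_compl_sqr.
pose M x := x - Y x.
have MM x : M (M x) = A (A x).
  have := YE x; rewrite /M !(scB _ _ Ysc) rmorph_nat scaler_nat mulr2n => YYx.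
  rewrite opprB addrACA -opprD YYx [x - _ + _]addrAC opprB addrC subrK.
  by [].
have MA x : M (A x) = A (M x) by rewrite /M YA -(scB _ _ Asc).
have Ms x y : dot (M x) y = dot x (M y).
  by rewrite /M dotBl dotBr (sc_sym _ _ Ysc).
have Msc : sym_contraction M.
  split=> // x; rewrite -(@ler_pXn2r _ 2) ?nnegrE ?rnorm_ge0 //.
  rewrite -rdotxx /rdot Ms MM -/(rdot x (A (A x))) -(sc_rdot _ _ Asc) rdotxx.
  by rewrite ler_pXn2r ?nnegrE ?rnorm_ge0 //; case: Asc.
have Mge0 x : 0 <= rdot (M x) x.
  rewrite /M !rdotE rdotxx subr_ge0 (le_trans (rdot_le _ _)) // expr2.
  by rewrite ler_wpM2r ?rnorm_ge0 //; case: Ysc.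
have NM : commutes N M.
  have := commutes_comb 1 (-1) Nlin (@commutes_id _ _ N) NY.
  by congr commutes; apply/funext => x; rewrite scale1r scaleN1r.
pose h : R := 2^-1.
(* The factor one half keeps [M + A] a contraction, so that its kernel projection [P] exists. *)
pose F x := h%:C *: M x + h%:C *: A x.
have Fsc : sym_contraction F.
  by apply: sc_comb => //; rewrite ger0_norm ?invr_ge0 // /h; lra.
have NF : commutes N F by exact: commutes_comb.
have [P [Psc PP PF Pcom]] := kernel_projection Fsc.
have F0 x : F x = 0 -> M x + A x = 0.
  rewrite /F -scalerDr => /eqP; rewrite scaler_eq0 fmorph_eq0 invr_eq0.
  by rewrite pnatr_eq0 /= => /eqP.
have [P0|P1] := Nirr Psc PP (Pcom _ Nlin Ncl NF).
(* If the kernel is trivial, it contains [M x - A x], so [A = M], which is nonnegative. Otherwise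
   the kernel is everything and [A = - M]. *)
- left=> x; have : F (M x - A x) = 0.
    rewrite /F (scB _ _ Msc) (scB _ _ Asc) MM MA -scalerDr.
    by rewrite addrA subrK subrr scaler0.
  by move=> /PF; rewrite P0 => /esym/eqP; rewrite subr_eq0 => /eqP <-.
- right=> x; have /eqP := F0 x ((PF x).1 (P1 x)).
  by rewrite addr_eq0 => /eqP Mx; have := Mge0 x; rewrite Mx rdotNl; lra.
Qed.

(** Each [T - c] is semidefinite, so every real [c] is an upper or a lower bound of the quadratic
    form of [T] relative to [|x|^2]. The least upper bound is then also a lower bound, and the form
    of [T - c] vanishes. *)
Lemma scalar_of_commutes T : sym_contraction T -> commutes N T ->
  exists c : R, forall x, T x = c%:C *: x.
Proof.
move=> Tsc NT.
(* Scaling by [k c] makes [T - c] a contraction, since [k c + k c * |c| = 1]. *)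
pose k (c : R) := (1 + `|c|)^-1.
have k0 c : 0 < k c by rewrite invr_gt0 ltr_pwDl.
pose A c x := (k c)%:C *: T x + (- (k c * c))%:C *: x.
have Asc c : sym_contraction (A c).
  apply: sc_comb => //.
  have kE : k c * (1 + `|c|) = 1 by rewrite mulVf // gt_eqF // ltr_pwDl.
  by rewrite normrN normrM (gtr0_norm (k0 c)) -kE mulrDr mulr1.
have AE c x : rdot (A c x) x = k c * (rdot (T x) x - c * rnorm x ^+ 2).
  by rewrite /A !rdotE rdotxx; ring.
have dich (c : R) : (forall x, c * rnorm x ^+ 2 <= rdot (T x) x) \/
    (forall x, rdot (T x) x <= c * rnorm x ^+ 2).
  have NA : commutes N (A c) by apply: commutes_comb.
  have [Age|Ale] := definite_of_commutes (Asc c) NA; [left|right] => x.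
    by have := Age x; rewrite AE pmulr_rge0 // subr_ge0.
  by have := Ale x; rewrite AE pmulr_rle0 // subr_le0.
have Tbd x : `|rdot (T x) x| <= rnorm x ^+ 2.
  have le y : rnorm y = rnorm x -> rdot (T y) x <= rnorm x ^+ 2.
    move=> yx; rewrite (le_trans (rdot_le _ _)) // expr2.
    by rewrite ler_wpM2r ?rnorm_ge0 //; rewrite -yx; case: Tsc.
  rewrite ler_norml lerNl -rdotNl -(scN _ Tsc).
  by rewrite !le ?rnormN.
(* The set [S] of upper bounds is bounded below only if there is a nonzero vector to test on. *)
have [x0|] := pselect (exists x : H, x != 0); last first.
  move=> /forallNP x0; exists 0 => x.
  have /negP : ~ (x != 0) by exact: x0.
  by rewrite negbK => /eqP ->; rewrite (sc0 Tsc) scaler0.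
case: x0 => x0 x0N0; have x00 : 0 < rnorm x0 ^+ 2 by rewrite exprn_gt0 ?rnorm_gt0.
pose S : set R := [set c | forall x, rdot (T x) x <= c * rnorm x ^+ 2].
have S1 : S 1 by move=> x; have := Tbd x; rewrite ler_norml mul1r => /andP[].
have Slb : lbound S (-1).
  move=> c /(_ x0); have := Tbd x0; rewrite ler_norml => /andP[+ _].
  by move=> h1 h2; rewrite -(ler_pM2r x00) mulN1r (le_trans h1).
have Sinf : has_inf S by split; [exists 1|exists (-1)].
pose c := inf S.
exists c => x; apply/eqP; rewrite -subr_eq0; apply/eqP.
have upper y : rdot (T y) y <= c * rnorm y ^+ 2.
  apply/ler_addgt0Pr => e e0.
  have e1 : 0 < e / (rnorm y ^+ 2 + 1) by rewrite divr_gt0 // ltr_wpDl ?exprn_ge0 ?rnorm_ge0.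
  have [b Sb bc] := inf_adherent e1 Sinf.
  apply: (le_trans (Sb y)).
  have y0 : 0 <= rnorm y ^+ 2 by rewrite exprn_ge0 ?rnorm_ge0.
  apply: (@le_trans _ _ ((c + e / (rnorm y ^+ 2 + 1)) * rnorm y ^+ 2)).
    by rewrite ler_wpM2r // ltW.
  rewrite mulrDl lerD2l -mulrA ger_pMr // mulrC ler_pdivrMr; lra.
have lower y : c * rnorm y ^+ 2 <= rdot (T y) y.
  apply/ler_addgt0Pr => e e0.
  have y0 : 0 <= rnorm y ^+ 2 by rewrite exprn_ge0 ?rnorm_ge0.
  pose d := e / (rnorm y ^+ 2 + 1).
  have d0 : 0 < d by rewrite divr_gt0 //; lra.
  (* Below the infimum, [c - d] is no upper bound, so the dichotomy makes it a lower bound. *)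
  have [ge|le] := dich (c - d); last first.
    by have := ge_inf Sinf.2 le; rewrite -/c; lra.
  have := ge y; rewrite mulrBl.
  have : d * rnorm y ^+ 2 <= e.
    rewrite /d -mulrA ger_pMr // mulrC ler_pdivrMr; lra.
  lra.
have : A c x = 0.
  apply: sc_rdot_eq0 => // y; rewrite AE.
  have -> : rdot (T y) y = c * rnorm y ^+ 2.
    by apply/eqP; rewrite eq_le upper lower.
  by rewrite subrr mulr0.
rewrite /A rmorphN rmorphM /= scaleNr -scalerA -scalerBr => /eqP.
by rewrite scaler_eq0 fmorph_eq0 gt_eqF //= => /eqP.
Qed.

End no_reduction.

End irreducible_normal_operators.

(** * Adjoints, the resolvent of [N^* N], and scalar normal operators *)

Section normal_operators.
Variables (R : realType) (H : hilbertType R).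
Implicit Types (x y z l : H) (P Q A T : H -> H) (N : operator H H).

Lemma seq_closed_graph N : closed (graph N) -> seq_closed N.
Proof.
move=> Ncl u l m uN ul Nul.
suff [] : graph N (l, m) by move=> /= ? ->.
apply: (@closed_cvg _ _ \oo _ (fun n => (u n, N (u n))) _ Ncl).
  by near=> n; split=> /=.
exact: cvg_pair.
Unshelve. all: by end_near. Qed.

(** Some [x] in [D] would satisfy [|z - x| < |z|], against Pythagoras. *)
Lemma dense_orthogonal (D : set H) z : dense D ->
  (forall x, D x -> dot x z = 0) -> z = 0.
Proof.
move=> Dd Dz; apply/eqP; apply: contraPT isT => z0.
have z0' : 0 < `|z| by rewrite normr_gt0.
have [||x [xz Dx]] := Dd (ball z `|z|).
- by exists z; exact: ballxx.
- exact: ball_open.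
have := xz; rewrite -ball_normE /= !rnormE ltcR.
rewrite -(@ltr_pXn2r _ 2) ?nnegrE ?rnorm_ge0 //.
rewrite -rdotxx !rdotE !rdotxx (rdotC z x).
have -> : rdot x z = 0 by rewrite /rdot Dz.
have := exprn_ge0 2 (rnorm_ge0 x); lra.
Qed.

(** Density makes the related vector unique, so the choice by [xget] must return it. *)
Lemma adjointE (K : hilbertType R) (A : operator H K) (y : K) z :
  dense (dom A) -> adjoint_rel A y z -> dom (adjoint A) y /\ adjoint A y = z.
Proof.
move=> Nd Nyz; split; first by exists z.
apply: xget_unique => // z' Nyz'.
apply/eqP; rewrite -subr_eq0; apply/eqP.
apply: (dense_orthogonal Nd) => x Nx.
by rewrite dotBr -Nyz // -Nyz' // subrr.
Qed.

Lemma adjointP N y : dom (adjoint N) y -> adjoint_rel N y (adjoint N y).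
Proof. by move=> [z Nyz]; exact: xgetI Nyz. Qed.

(* [B = (1 + N^* N)^-1], obtained by projecting [(h, 0)] on the graph of [N]. *)
Lemma resolvent_exists N : linear_op N -> seq_closed N ->
  exists B : H -> H, forall h, dom N (B h) /\
    forall y, dom N y -> dot (B h) y + dot (N (B h)) (N y) = dot h y.
Proof.
move=> [N0 Nlin] Ncl.
suff /choice [B BP] h : exists b, dom N b /\
    forall y, dom N y -> dot b y + dot (N b) (N y) = dot h y by exists B.
have N00 : N 0 = 0.
  by have [_] := Nlin 0 0 _ _ N0 N0; rewrite !scale0r addr0.
pose G : set (hsum H H) := [set p | dom N p.1 /\ p.2 = N p.1].
have [|a p q [p1 p2] [q1 q2]|u l uG ul|[x w] /= [Nx /= ->] xort] :=
    @orthogonal_projection R (hsum H H) G (h, 0).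
- by split=> //=; rewrite N00.
- have [] := Nlin a 1 _ _ p1 q1; rewrite !scale1r => Npq NpqE.
  by split=> //=; rewrite p2 q2 NpqE.
- have u1 : (fun n => (u n).1) @ \oo --> l.1.
    apply/rcvgP => e e0; move/rcvgP : ul => /(_ _ e0) [n nP].
    exists n => k /nP; apply: le_lt_trans.
    by rewrite -lecR -!rnormE; exact: (hsum_norm_fst (l - u k)).
  have u2 : (fun n => N (u n).1) @ \oo --> l.2.
    apply/rcvgP => e e0; move/rcvgP : ul => /(_ _ e0) [n nP].
    exists n => k /nP; apply: le_lt_trans.
    have [_ <-] := uG k.
    by rewrite -lecR -!rnormE; exact: (hsum_norm_snd (l - u k)).
  by have [|] := Ncl _ _ _ _ u1 u2; first by move=> n; case: (uG n).
exists x; split=> // y Ny.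
have := xort (y, N y) (conj Ny erefl).
have -> : dot ((h, 0) - (x, N x) : hsum H H) (y, N y) =
    dot (h - x) y + dot (0 - N x) (N y) by [].
rewrite sub0r dotNl dotBl -addrA -opprD => /eqP; rewrite subr_eq0.
by move=> /eqP.
Qed.

Section resolvent.
Variables (N : operator H H) (B : H -> H).
Hypotheses (Nlin : linear_op N).
Hypothesis BP : forall h, dom N (B h) /\
  forall y, dom N y -> dot (B h) y + dot (N (B h)) (N y) = dot h y.

Lemma linear_opD x y : dom N x -> dom N y -> dom N (x + y) /\ N (x + y) = N x + N y.
Proof. by move=> Nx Ny; have [_ /(_ 1 1 x y Nx Ny)] := Nlin; rewrite !scale1r. Qed.

Lemma linear_opB x y : dom N x -> dom N y -> dom N (x - y) /\ N (x - y) = N x - N y.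
Proof.
move=> Nx Ny; have [_ /(_ 1 (-1) x y Nx Ny)] := Nlin.
by rewrite !scale1r !scaleN1r.
Qed.

(** Testing the difference [d] of two solutions against itself gives [|d|^2 + |N d|^2 = 0]. *)
Lemma resolvent_unique h x : dom N x ->
  (forall y, dom N y -> dot x y + dot (N x) (N y) = dot h y) -> B h = x.
Proof.
move=> Nx xP; have [NB BhP] := BP h; have [Nd NdE] := linear_opB NB Nx.
have := BhP _ Nd; rewrite -(xP _ Nd) => /eqP; rewrite -subr_eq0.
rewrite opprD addrACA -!dotBl -NdE !dotxx paddr_eq0 ?exprn_ge0 //.
by rewrite sqrf_eq0 normr_eq0 subr_eq0 => /andP[/eqP].
Qed.

(** Both sides of the symmetry equal [dot (B x) (B y) + dot (N (B x)) (N (B y))]. Testing against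
    [B x] gives [|B x|^2 <= |x| |B x|]. *)
Lemma resolvent_sc : sym_contraction B.
Proof.
split=> [x y|x].
  rewrite -(BP x).2; last exact: (BP y).1.
  have := congr1 Num.conj ((BP y).2 _ (BP x).1).
  by rewrite rmorphD /= -!dot_conj.
have := rdot_le x (B x); rewrite /rdot -(BP x).2; last exact: (BP x).1.
rewrite raddfD /= -!/(rdot _ _) !rdotxx.
have := rnorm_ge0 (B x); have := exprn_ge0 2 (rnorm_ge0 (N (B x))).
rewrite [0 <= rnorm _]le_eqVlt => nN /orP[/eqP <- _|p0 le].
  exact: rnorm_ge0.
rewrite -(ler_pM2r p0); apply: le_trans le.
by rewrite -expr2 lerDl.
Qed.

(** The defining equation says [N^* N B x = x - B x]. For [x] in the domain of [N], applying [N] and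
    using normality turns it into [N^* N (N B x) = N x - N B x], so [N B x] solves the equation
    defining [B (N x)]. *)
Lemma resolvent_commutes : dense (dom N) ->
  op_eq (op_comp (adjoint N) N) (op_comp N (adjoint N)) -> commutes N B.
Proof.
move=> Nd [domE appE] x Nx; have [NBx BxP] := BP x.
have adj : adjoint_rel N (N (B x)) (x - B x).
  move=> u Nu; rewrite dotBr (dot_conj u x) -(BxP u Nu) rmorphD /=.
  by rewrite -!dot_conj addrAC subrr add0r.
have [adjd adjE] := adjointE Nd adj.
have [NxB NxBE] := linear_opB Nx NBx.
have : dom (op_comp N (adjoint N)) (N (B x)) by apply: (conj adjd); rewrite adjE.
rewrite -domE => NNd; have [NNB adj2] := NNd.
have adj2E : adjoint N (N (N (B x))) = N (adjoint N (N (B x))) := appE _ NNd.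
rewrite adjE NxBE in adj2E.
split=> //; apply/esym/resolvent_unique => // y Ny.
rewrite (dot_conj (N (N _))) (adjointP adj2 Ny) adj2E -dot_conj dotBl.
by rewrite addrC subrK.
Qed.

End resolvent.

Lemma real_sqr_bound (c : R) : 0 <= c -> c <= (1 + c) ^+ 2.
Proof. by move=> c0; nra. Qed.

Lemma normal_scalar N : normal_op N -> no_reducing_projection N ->
  exists w : R[i], dom N = setT /\ forall x, N x = w *: x.
Proof.
move=> [Nlin Nd /seq_closed_graph Ncl Nnormal] Nirr.
have [B BP] := resolvent_exists Nlin Ncl.
have [b BE] := scalar_of_commutes Nlin Ncl Nirr (resolvent_sc BP)
  (resolvent_commutes Nlin BP Nd Nnormal).
(* If [B = 0], every vector is orthogonal to the dense domain and the space is zero. *)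
have [b0|b0] := eqVneq b 0.
  have H0 x : x = 0.
    apply: (dense_orthogonal Nd) => y Ny.
    have := (BP x).2 y Ny; rewrite BE b0 scale0r dot0l add0r.
    have [_ N00] := commutes_zero Nlin Nlin.1.
    by rewrite N00 dot0l => xy; rewrite dot_conj -xy conjC0.
  exists 0; split=> [|x]; last by rewrite (H0 (N x)) scale0r.
  by apply/seteqP; split=> // x _; rewrite (H0 x); exact: Nlin.1.
have bN0 : b%:C != 0 :> R[i] by rewrite fmorph_eq0.
have Nall x : dom N x.
  have := (BP (b%:C^-1 *: x)).1.
  by rewrite BE scalerA divff // scale1r.
(* Since [b (1 + N^* N) = 1], this is the scalar by which [N^* N] acts. *)
pose c := b^-1 - 1.
have NN x y : dot (N x) (N y) = c%:C * dot x y.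
  have := (BP (b%:C^-1 *: x)).2 y (Nall y).
  rewrite BE scalerA divff // scale1r dotZl => /(canRL (addKr _)) ->.
  by rewrite /c rmorphB fmorphV rmorph1 mulrBl mul1r addrC.
have NNadj x : adjoint_rel N (N x) (c%:C *: x).
  by move=> y _; rewrite NN dotZr [X in _ = X * _]conjc_real.
have NNall x : dom (op_comp (adjoint N) N) x.
  by split; [exact: Nall|exact: (adjointE Nd (NNadj x)).1].
pose N' := adjoint N.
have N'N x : N' (N x) = c%:C *: x by exact: (adjointE Nd (NNadj x)).2.
have NN' x : N (N' x) = c%:C *: x.
  by rewrite -N'N; have := Nnormal.2 x (NNall x).
have N'P x y : dot (N x) y = dot x (N' y).
  apply: adjointP (Nall x); move: (NNall y).
  by rewrite Nnormal.1 => -[].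
have Nsq x : rnorm (N x) ^+ 2 = c * rnorm x ^+ 2.
  by rewrite -rdotxx /rdot NN dotxx_rnorm -rmorphM.
have N'sq x : rnorm (N' x) ^+ 2 = c * rnorm x ^+ 2.
  rewrite -rdotxx /rdot -N'P NN' dotZl dotxx_rnorm -rmorphM //.
pose s := 1 + `|c|.
have s0 : 0 < s by rewrite ltr_pwDl.
have le_of_sq x y : rnorm y ^+ 2 = c * rnorm x ^+ 2 -> rnorm y <= s * rnorm x.
  move=> yx; rewrite -(@ler_pXn2r _ 2) ?nnegrE ?mulr_ge0 ?rnorm_ge0 ?(ltW s0) //.
  rewrite yx exprMn ler_wpM2r ?exprn_ge0 ?rnorm_ge0 //.
  by rewrite (le_trans (ler_norm c)) // real_sqr_bound.
have Nadd x y : N (x + y) = N x + N y by exact: (linear_opD Nlin (Nall x) (Nall y)).2.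
have Nscale (a : R[i]) x : N (a *: x) = a *: N x.
  have [_ /(_ a 0 x x (Nall x) (Nall x))[_]] := Nlin.
  by rewrite !scale0r !addr0.
(* As [c <= s^2], both [N] and its adjoint are bounded by [s], so this factor makes each [A a] with
   [|a| = 1] a contraction. Up to real factors, [A 1] and [A 'i] are the real and imaginary parts of
   [N]. *)
pose k : R[i] := ((2 * s)^-1)%:C.
have kJ : k^* = k by exact: conjc_real.
have k0 : k != 0 by rewrite fmorph_eq0 invr_eq0 mulf_neq0 // gt_eqF.
pose A (a : R[i]) x := k *: (a *: N x + a^* *: N' x).
have Asc a : `|a| = 1 -> sym_contraction (A a).
  move=> a1; split=> [x y|x].
    rewrite /A !(dotZl, dotZr, dotDl, dotDr) kJ conjCK N'P.
    by rewrite [dot (N' x) y]dot_conj -(N'P y) -dot_conj addrC.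
  rewrite /A rnormZr ger0_norm ?invr_ge0 ?mulr_ge0 ?(ltW s0) //.
  rewrite mulrC ler_pdivrMr ?mulr_gt0 // (le_trans (rnormD _ _)) //.
  rewrite !rnormZ norm_conjC a1 /= !mul1r.
  have := le_of_sq _ _ (Nsq x); have := le_of_sq _ _ (N'sq x); lra.
have Acom a : commutes N (A a).
  move=> x _; split; first exact: Nall.
  by rewrite /A Nscale Nadd !Nscale NN' N'N.
have [a aE] := scalar_of_commutes Nlin Ncl Nirr (Asc 1 (normr1 _)) (Acom 1).
have [d dE] := scalar_of_commutes Nlin Ncl Nirr (Asc 'i (normCi _)) (Acom 'i).
exists ((2 * k)^-1 * (a%:C - 'i * d%:C)); split=> [|x].
  by apply/seteqP; split=> // x _.
(* [A 1 - 'i A 'i = 2 k N]: the adjoint terms cancel. *)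
have -> : ((2 * k)^-1 * (a%:C - 'i * d%:C)) *: x =
    (2 * k)^-1 *: (A 1 x - 'i *: A 'i x).
  by rewrite aE dE -scalerA scalerBl -scalerA.
rewrite /A conjC1 conjCi !(scalerBr, scalerDr, scalerA, scale1r).
rewrite opprD addrACA -!scalerBl.
have -> : (2 * k)^-1 * k - (2 * k)^-1 * 'i * k * 'i =
    (2 * k)^-1 * k * (1 - 'i * 'i) by ring.
have -> : (2 * k)^-1 * k - (2 * k)^-1 * 'i * k * - 'i =
    (2 * k)^-1 * k * (1 + 'i * 'i) by ring.
rewrite -expr2 sqrCi opprK subrr mulr0 scale0r addr0.
rewrite (_ : _ * (1 + 1) = 1) ?scale1r //.
by move: k k0 {kJ A Asc Acom aE dE} => k k0; field.
Qed.

Lemma line_projection e : e != 0 ->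
  let P x := (dot x e / dot e e) *: e in
  sym_contraction P /\ forall x, P (P x) = P x.
Proof.
move=> e0 P; have ee : dot e e != 0.
  by apply: contra_neq e0; exact: dotxx_eq0.
have PP x : P (P x) = P x by rewrite /P dotZl divfK.
split=> //; apply: sc_idempotent => // x y.
rewrite /P dotZl dotZr [dot e y]dot_conj fmorph_div /= -(dot_conj e e).
by field.
Qed.

(** A scalar operator commutes with the projection on any line, which must then be the identity. *)
Lemma scalar_span N (w : R[i]) : no_reducing_projection N ->
  (forall x, N x = w *: x) -> dom N = setT -> (exists x : H, x != 0) ->
  exists2 e : H, e != 0 & forall x, exists a, x = a *: e.
Proof.
move=> Nirr NE Nall [e e0]; exists e => // x.
have [Psc PP] := line_projection e0.
have NP : commutes N (fun x => (dot x e / dot e e) *: e).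
  by move=> y Ny; rewrite Nall !NE dotZl !scalerA mulrA.
have [P0|P1] := Nirr _ Psc PP NP; last by exists (dot x e / dot e e).
have := P0 e; rewrite divff ?scale1r; first by move/eqP: e0.
by apply: contra_neq e0; exact: dotxx_eq0.
Qed.

End normal_operators.

(** * Reducing projections *)

Section reduction.
Variables (R : realType) (H : hilbertType R).
Implicit Types (x y z : H) (P Q : H -> H) (T : operator H H).

Lemma closed_subspace_kernel Q : sym_contraction Q ->
  closed_subspace [set x | Q x = 0].
Proof.
move=> Qsc; split=> [|a x y /= Qx Qy|x /= xcl].
- exact: sc0.
- by rewrite (scD _ _ Qsc) (scZ _ _ Qsc) Qx Qy scaler0 addr0.
apply/eqP; apply: contraPT isT => Qx.
have Qx0 : 0 < `|Q x| by rewrite normr_gt0.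
have [y [/= Qy]] := xcl _ (nbhsx_ballx x _ Qx0).
rewrite -ball_normE /= !rnormE ltcR => lt.
have := sc_nonexpansive x y Qsc; rewrite Qy subr0 => le.
by have := le_lt_trans le lt; rewrite ltxx.
Qed.

Lemma antilinear_restriction T Q : antilinear_op T -> sym_contraction Q ->
  antilinear_op (Operator (dom T `&` [set x | Q x = 0]) T).
Proof.
move=> [T0 Tlin] Qsc; split=> [|a b x y [Tx Qx] [Ty Qy]].
  by split=> //=; exact: sc0.
have [Txy TxyE] := Tlin a b x y Tx Ty; split=> //; split=> //=.
by rewrite (sc_linear _ _ _ _ Qsc) Qx Qy !scaler0 addr0.
Qed.

Lemma reducible_of_projection T P : antilinear_op T -> sym_contraction P ->
  (forall x, P (P x) = P x) -> commutes T P ->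
  (exists x, P x != 0) -> (exists x, P x != x) -> reducible T.
Proof.
move=> Tlin Psc PP TP [x0 x0P] [x1 x1P].
pose Q x := x - P x.
have Qsc : sym_contraction Q.
  apply: sc_idempotent => [x y|x].
    by rewrite dotBl dotBr (sc_sym _ _ Psc).
  by rewrite /Q (scB _ _ Psc) PP subrr subr0.
have QP x : Q (P x) = 0 by rewrite /Q PP subrr.
have PQ x : P (Q x) = 0 by rewrite /Q (scB _ _ Psc) PP subrr.
have PQD x : P x + Q x = x by rewrite addrC subrK.
have QPx x : Q x = 0 -> P x = x by move/eqP; rewrite subr_eq0 => /eqP.
(* The range of [P] is written as the kernel of [Q = 1 - P], so both summands are kernels and are
   closed for the same reason. *)
pose G (A : H -> H) : set H := [set x | A x = 0].
pose S (A : H -> H) := Operator (dom T `&` G A) T.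
have TQ x : dom T x -> dom T (Q x).
  move=> Tx; have [Px _] := TP x Tx.
  have [_ /(_ 1 (-1) x (P x) Tx Px)[+ _]] := Tlin.
  by rewrite scale1r scaleN1r.
have TD x y : dom T x -> dom T y -> dom T (x + y) /\ T (x + y) = T x + T y.
  move=> Tx Ty; have [_ /(_ 1 1 x y Tx Ty)] := Tlin.
  by rewrite conjC1 !scale1r.
have T0 : T 0 = 0.
  have [T0 /(_ 0 0 0 0 T0 T0)[_]] := Tlin.
  by rewrite conjC0 !scale0r addr0.
exists (G Q), (G P), (S Q), (S P); split.
- split=> [||x y /= Qx Py|x]; try exact: closed_subspace_kernel.
    by rewrite -(QPx _ Qx) (sc_sym _ _ Psc) Py dot0r.
  by exists (P x), (Q x); split=> //=; rewrite PQD.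
- split=> G0.
    have /= Px0 : [set 0] (P x0) by rewrite -G0; exact: QP.
    by move: x0P; rewrite Px0 eqxx.
  have : [set 0] (Q x1) by rewrite -G0; exact: PQ.
  by move=> /= /eqP; rewrite subr_eq0 eq_sym (negbTE x1P).
- split; [by right; exact: antilinear_restriction|by move=> ? []|].
  move=> x [Tx /QPx Px]; have [_] := TP x Tx.
  by rewrite Px /G /Q /= => <-; rewrite subrr.
- split; [by right; exact: antilinear_restriction|by move=> ? []|].
  move=> x [Tx /= Px]; have [_] := TP x Tx.
  by rewrite Px T0 /G /= => <-.
split=> [|x y [Tx _] [Ty _]]; last by case: (TD x y Tx Ty).
apply/seteqP; split=> [x Tx|_ [x [y [[Tx _] [Ty _] ->]]]].
  exists (P x), (Q x); split=> //.
    by split; [case: (TP x Tx)|exact: QP].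
  by split; [exact: TQ|exact: PQ].
by case: (TD x y Tx Ty).
Qed.

Lemma has_dim1P :
  has_dim H 1 <-> exists2 e : H, e != 0 & forall x, exists a, x = a *: e.
Proof.
split=> [[e eP]|[e e0 eP]].
  exists (e ord0) => [|x].
    apply/eqP => e0; have [a [_ aU]] := eP 0.
    have sum0 (b : {ffun 'I_1 -> R[i]}) : 0 = \sum_(i < 1) b i *: e i.
      by rewrite big_ord1 e0 scaler0.
    have := aU [ffun=> 0] (sum0 _); rewrite (aU [ffun=> 1] (sum0 _)).
    by move=> /ffunP/(_ ord0)/eqP; rewrite !ffunE oner_eq0.
  by have [a [+ _]] := eP x; rewrite big_ord1 => ->; exists (a ord0).
exists (fun=> e) => x; have [a ->] := eP x.
exists [ffun=> a]; split=> [|b]; first by rewrite big_ord1 ffunE.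
rewrite big_ord1 => /eqP; rewrite -subr_eq0 -scalerBl scaler_eq0 (negbTE e0).
rewrite orbF subr_eq0 => /eqP ->; apply/ffunP => i.
by rewrite ffunE (ord1 i).
Qed.

Lemma unit_span : (exists2 e : H, e != 0 & forall x, exists a, x = a *: e) ->
  exists e : H, dot e e = 1 /\ forall x, x = dot x e *: e.
Proof.
move=> [e e0 eP]; have r0 : 0 < rnorm e by exact: rnorm_gt0.
pose u := ((rnorm e)^-1)%:C *: e.
have uu : dot u u = 1.
  rewrite dotxx_rnorm rnormZr ger0_norm ?invr_ge0 ?(ltW r0) // mulVf ?gt_eqF //.
  by rewrite expr1n.
have eE : e = (rnorm e)%:C *: u.
  by rewrite scalerA -rmorphM divff ?gt_eqF // rmorph1 scale1r.
exists u; split=> // x; have [a ->] := eP x.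
move: eE uu; clearbody u => -> uu.
by rewrite scalerA dotZl uu mulr1.
Qed.

End reduction.

(** * The model operator *)

(** Polarisation preserves the real part; pulling ['i] inside [c] as [- 'i] changes the sign of the
    imaginary part, hence the exchanged arguments. *)
Lemma antilinear_isometry_dot (R : realType) (H : hilbertType R) (c : H -> H) :
  antilinear_op (total_op c) -> (forall x, `|c x| = `|x|) ->
  forall x y, dot (c x) (c y) = dot y x.
Proof.
move=> [_ clin] ciso x y.
have cr z : rnorm (c z) = rnorm z by rewrite /rnorm ciso.
have cD u v : c (u + v) = c u + c v.
  by have [_] := clin 1 1 u v I I; rewrite /= conjC1 !scale1r.
have cZ a u : c (a *: u) = a^* *: c u.
  by have [_] := clin a 0 u u I I; rewrite /= conjC0 !scale0r !addr0.
have rs u v : rdot (c u) (c v) = rdot u v.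
  have : rdot (c (u + v)) (c (u + v)) = rdot (u + v) (u + v).
    by rewrite !rdotxx cr.
  by rewrite cD !rdotE !rdotxx !cr (rdotC (c v)) (rdotC v); lra.
rewrite [RHS]dot_conj !dot_rdot rs.
have -> : 'i *: c y = c (- 'i *: y) by rewrite cZ rmorphN /= conjCi opprK.
rewrite rs scaleNr rdotNr.
move: (rdot x y) (rdot x _) => a b; apply/eqP.
by rewrite eq_complex /=; apply/andP; split; apply/eqP; ring.
Qed.

Section model.
Variables (R : realType) (H1 H2 : hilbertType R).
Variables (N1 : operator H1 H1) (N2 : operator H2 H2).
Variables (C1 : H1 -> H2) (C2 : H2 -> H1).
Hypothesis HT : model_data N1 N2 C1 C2.
Local Notation T := (model_op N1 N2 C1 C2).
Local Notation c := (antidiag C1 C2).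
Local Notation hpair x y := ((x, y) : hsum H1 H2).

Let N1lin : linear_op N1. Proof. by case: HT => -[]. Qed.
Let N2lin : linear_op N2. Proof. by case: HT => _ []. Qed.

Lemma model_c_lin (a b : R[i]) x y : c (a *: x + b *: y) = a^* *: c x + b^* *: c y.
Proof. by case: HT => _ _ [[_ clin] _ _] _; have [_] := clin a b x y I I. Qed.

Lemma model_C1Z (a : R[i]) x : C1 (a *: x) = a^* *: C1 x.
Proof.
have := congr1 snd (model_c_lin a 0 (hpair x 0) 0).
by rewrite /= !scale0r !conjC0 !scale0r !addr0.
Qed.

Lemma model_C2Z (a : R[i]) x : C2 (a *: x) = a^* *: C2 x.
Proof.
have := congr1 fst (model_c_lin a 0 (hpair 0 x) 0).
by rewrite /= !scale0r !conjC0 !scale0r !addr0.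
Qed.

Lemma model_C10 : C1 0 = 0.
Proof. by rewrite -(scale0r 0) model_C1Z conjC0 !scale0r. Qed.

Lemma model_C20 : C2 0 = 0.
Proof. by rewrite -(scale0r 0) model_C2Z conjC0 !scale0r. Qed.

Lemma model_C1K x : C2 (C1 x) = x.
Proof. by case: HT => _ _ [_ _ cK] _; have := congr1 fst (cK (hpair x 0)). Qed.

Lemma model_C2K x : C1 (C2 x) = x.
Proof. by case: HT => _ _ [_ _ cK] _; have := congr1 snd (cK (hpair 0 x)). Qed.

Lemma model_c_dot x y : dot (c x) (c y) = dot y x.
Proof. by case: HT => _ _ [clin ciso _] _; exact: antilinear_isometry_dot. Qed.

Lemma model_C1dot x y : dot (C1 x) (C1 y) = dot y x.
Proof.
have : dot (C2 0) (C2 0) + dot (C1 x) (C1 y) = dot y x + dot (0 : H2) 0.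
  exact: (model_c_dot (hpair x 0) (hpair y 0)).
by rewrite model_C20 !dot0l add0r addr0.
Qed.

Lemma model_C2dot x y : dot (C2 x) (C2 y) = dot y x.
Proof. by rewrite -model_C1dot !model_C2K. Qed.

(** The commutation of the diagonal operator with the conjugation, evaluated at [(x, 0)] and read in
    the second component. *)
Lemma model_N2C1 x :
  (dom N2 (C1 x) <-> dom N1 x) /\ (dom N1 x -> N2 (C1 x) = C1 (N1 x)).
Proof.
have [_ _ _ [domE appE]] := HT.
have N10 := N1lin.1; have N20 := N2lin.1.
have E : dom (op_comp (diag_op N1 N2) (total_op c)) (hpair x 0) <->
    dom (op_comp (total_op c) (diag_op N1 N2)) (hpair x 0) by rewrite domE.
split.
  split=> [NC|N].
    have [|[]//] := E.1; split=> //; split=> //=; by rewrite model_C20.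
  have [|_ []//] := E.2; by split.
move=> N; have D := E.2 (conj (conj N N20) I).
exact: (congr1 snd (appE _ D)).
Qed.

Lemma model_domE x : dom T x <-> dom N1 x.1 /\ dom N2 x.2.
Proof.
have e1 := (model_N2C1 x.1).1; have e2 := (model_N2C1 (C2 x.2)).1.
rewrite model_C2K in e2.
split=> [[_ [/= n1 n2]]|[n1 n2]]; first by split; [exact/e1|exact/e2].
by split=> //; split=> /=; [exact/e2|exact/e1].
Qed.

Lemma model_antilinear : antilinear_op T.
Proof.
split=> [|a b x y [_ [x1 x2]] [_ [y1 y2]]].
  by apply/model_domE; split; [exact: N1lin.1|exact: N2lin.1].
have [d1 E1] := N1lin.2 (a^*) (b^*) _ _ x1 y1.
have [d2 E2] := N2lin.2 (a^*) (b^*) _ _ x2 y2.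
have := model_c_lin a b x y => cE.
split.
  by split=> //; rewrite [total_op c _]cE; split; [exact: d1|exact: d2].
have -> : T (a *: x + b *: y) = diag_op N1 N2 (c (a *: x + b *: y)) by [].
by rewrite cE; congr pair; [exact: E1|exact: E2].
Qed.

Lemma model_no_reducing_projection : irreducible T -> no_reducing_projection N1.
Proof.
move=> Tirr P Psc PP NP.
apply: contrapT => /not_orP[/existsNP[x0 /eqP x0P] /existsNP[x1 /eqP x1P]].
apply: Tirr.
pose Q (x : hsum H1 H2) := hpair (P x.1) (C1 (P (C2 x.2))).
have QQ x : Q (Q x) = Q x by rewrite /Q /= model_C1K !PP.
apply: (@reducible_of_projection _ _ _ Q) => //.
- exact: model_antilinear.
- apply: sc_idempotent => // x y.
  have -> : dot (Q x) y = dot (P x.1) y.1 + dot (C1 (P (C2 x.2))) y.2 by [].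
  have -> : dot x (Q y) = dot x.1 (P y.1) + dot x.2 (C1 (P (C2 y.2))) by [].
  rewrite (sc_sym _ _ Psc); congr (_ + _).
  (* [C2] and [C1] each exchange the arguments of the inner product; the two exchanges cancel, so
     the second block is symmetric. *)
  rewrite -model_C2dot model_C1K -(sc_sym _ _ Psc) -model_C1dot.
  by rewrite model_C2K.
- move=> x /model_domE[n1 n2].
  have n2' : dom N1 (C2 x.2) by apply/(model_N2C1 _).1; rewrite model_C2K.
  have [p1 q1] := NP _ n1; have [p2 q2] := NP _ n2'.
  split; first by apply/model_domE; split=> //=; apply/(model_N2C1 _).1.
  have -> : T (Q x) = hpair (N1 (C2 (C1 (P (C2 x.2))))) (N2 (C1 (P x.1))) by [].
  have -> : Q (T x) = hpair (P (N1 (C2 x.2))) (C1 (P (C2 (N2 (C1 x.1))))) by [].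
  rewrite model_C1K q2 !(model_N2C1 _).2 // q1.
  by rewrite model_C1K.
- exists (hpair x0 0); apply: contra_neq x0P; exact: (congr1 fst).
- exists (hpair x1 0); apply: contra_neq x1P; exact: (congr1 fst).
Qed.

Lemma model_span12 :
  (exists2 e : H1, e != 0 & forall x, exists a, x = a *: e) <->
  (exists2 f : H2, f != 0 & forall y, exists b, y = b *: f).
Proof.
split=> [[e e0 eP]|[f f0 fP]].
  exists (C1 e) => [|y].
    by apply: contra_neq e0 => Ce; rewrite -(model_C1K e) Ce model_C20.
  by have [a aE] := eP (C2 y); exists (a^*); rewrite -(model_C2K y) aE model_C1Z.
exists (C2 f) => [|x].
  by apply: contra_neq f0 => Cf; rewrite -(model_C2K f) Cf model_C10.
by have [a aE] := fP (C1 x); exists (a^*); rewrite -(model_C1K x) aE model_C2Z.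
Qed.

Lemma model_neq0 : (exists x : hsum H1 H2, x != 0) -> exists x : H1, x != 0.
Proof.
move=> [[x y] xy0]; have [x0|x0] := eqVneq x 0; last by exists x.
exists (C2 y); apply: contra_neq xy0 => Cy.
by rewrite x0 -(model_C2K y) Cy model_C10.
Qed.

Lemma model_irreducible_span : (exists x : hsum H1 H2, x != 0) ->
  irreducible T ->
  exists (w : R[i]) (e : H1), [/\ dom N1 = setT, forall x, N1 x = w *: x, dot e e = 1 &
    forall x, x = dot x e *: e].
Proof.
move=> /model_neq0 x0 /model_no_reducing_projection Nirr.
have [N1normal _ _ _] := HT.
have [w [Nall NE]] := normal_scalar N1normal Nirr.
have [e [ee eP]] := unit_span (scalar_span Nirr NE Nall x0).
by exists w, e.
Qed.

(** * The model operator when [N1] is a scalar on a line *)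

Section scalar_model.
Variables (w : R[i]) (e : H1).
Hypotheses (Nall : dom N1 = setT) (NE : forall x, N1 x = w *: x).
Hypotheses (ee : dot e e = 1) (eP : forall x, x = dot x e *: e).
Local Notation f := (C1 e).

Lemma scalar_model_dom : dom T = setT.
Proof.
apply/seteqP; split=> // x _; apply/model_domE; rewrite Nall; split=> //.
by rewrite -(model_C2K x.2); apply/(model_N2C1 _).1; rewrite Nall.
Qed.

Lemma scalar_modelE x : T x = hpair (w *: C2 x.2) (w^* *: C1 x.1).
Proof.
have -> : T x = hpair (N1 (C2 x.2)) (N2 (C1 x.1)) by [].
by rewrite (model_N2C1 _).2 ?Nall // !NE model_C1Z.
Qed.

Lemma scalar_model_ff : dot f f = 1.
Proof. by rewrite model_C1dot. Qed.

Lemma scalar_model_fP y : y = dot y f *: f.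
Proof.
rewrite -{1}(model_C2K y) {1}(eP (C2 y)) model_C1Z -dot_conj -model_C1dot.
by rewrite model_C2K.
Qed.

Lemma scalar_model_coord a b :
  T (hpair (a *: e) (b *: f)) = hpair ((w * b^*) *: e) ((w^* * a^*) *: f).
Proof. by rewrite scalar_modelE /= model_C2Z model_C1K model_C1Z !scalerA. Qed.

(** For real [w] one has [T = w c], and [c] fixes [u = (e, C1 e)], so the line of [u] reduces [T];
    the vector [(e, - C1 e)] shows that this line is not the whole space. *)
Lemma scalar_model_nonreal : irreducible T -> w \isn't Num.real.
Proof.
move=> Tirr; apply/negP => wreal; apply: Tirr.
have wJ : w^* = w by exact: conj_Creal.
pose u := hpair e f.
have dotE (x y : hsum H1 H2) : dot x y = dot x.1 y.1 + dot x.2 y.2 by [].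
have uu : dot u u = 2 by rewrite dotE /= ee scalar_model_ff.
have u0 : u != 0.
  by apply/eqP => u0; move/eqP: uu; rewrite u0 dot0l eq_sym pnatr_eq0.
have Tc x : T x = w *: c x by rewrite scalar_modelE wJ.
have cu : c u = u by rewrite /antidiag /= model_C1K.
have vu : dot (hpair e (- f)) u = 0.
  by rewrite dotE /= ee dotNl scalar_model_ff subrr.
clearbody u; have [Psc PP] := line_projection u0.
apply: (reducible_of_projection model_antilinear Psc PP).
- move=> x _; split; first by rewrite scalar_model_dom.
  have cZ a : c (a *: u) = a^* *: u.
    by have := model_c_lin a 0 u 0; rewrite scaler0 conjC0 scale0r !addr0 cu.
  have Tu : dot (T x) u = w * dot u x by rewrite Tc dotZl -{1}cu model_c_dot.
  rewrite Tu uu Tc cZ fmorph_div /= -dot_conj conjC_nat scalerA mulrA.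
  by [].
- exists u; rewrite divff ?scale1r //.
  by rewrite uu pnatr_eq0.
- exists (hpair e (- f)).
  rewrite vu mul0r scale0r eq_sym.
  apply/eqP => /(congr1 fst) /= e0.
  by move/eqP: ee; rewrite e0 dot0l eq_sym oner_eq0.
Qed.

(** A nonzero [v] in [G1] and its image [T v] span the whole two-dimensional space, so nothing is
    left for [G2]. *)
Lemma scalar_model_irreducible : w \isn't Num.real -> irreducible T.
Proof.
move=> wNreal [G1 [G2 [S1 [S2 [[cl1 cl2 ort dec] [G1N0 G2N0] on1 on2 [domE TE]]]]]].
have [S1lin dS1 S1G] := on1; have [S2lin dS2 S2G] := on2.
have [G10 G1lin _] := cl1; have [G20 G2lin _] := cl2.
have S20 : dom S2 0 /\ S2 0 = 0.
  by case: S2lin => -[d0 /(_ 0 0 0 0 d0 d0)[_]]; rewrite ?conjC0 !scale0r !addr0.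
have TG v : G1 v -> G1 (T v).
  move=> Gv; have : dom T v by rewrite scalar_model_dom.
  rewrite domE => -[x1 [x2 [d1 d2 vE]]].
  (* The second part [x2 = v - x1] lies in both [G1] and [G2]. *)
  have x20 : x2 = 0.
    apply: dotxx_eq0; apply: ort; last exact: dS2.
    have -> : x2 = (-1) *: x1 + v by rewrite vE scaleN1r addrA addNr add0r.
    by apply: G1lin => //; exact: dS1.
  by rewrite vE TE // x20 S20.2 addr0; exact: S1G.
apply: G2N0; apply/seteqP; split=> [y Gy|_ ->] //=.
have [v Gv v0] : exists2 v, G1 v & v != 0.
  apply: contrapT => /forall2NP nv; apply: G1N0.
  apply/seteqP; split=> [v Gv|_ ->] //=.
  by have [//|/negP] := nv v; rewrite negbK => /eqP.
apply: dotxx_eq0; apply: ort => //.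
case: v Gv v0 => v1 v2; rewrite (eP v1) (scalar_model_fP v2).
move: (dot v1 e) (dot v2 f) => a b Gv v0.
have GTv := TG _ Gv; rewrite scalar_model_coord in GTv.
(* The determinant of [v] and [T v] in the basis [(e, 0)], [(0, f)]; its imaginary part is
   [- Im w (|a|^2 + |b|^2)]. *)
pose d := a * (w^* * a^*) - b * (w * b^*).
have d0 : d != 0.
  apply: contra_neq v0 => d0.
  suff [-> ->] : a = 0 /\ b = 0 by rewrite !scale0r.
  have dE : w^* * `|a| ^+ 2 = w * `|b| ^+ 2.
    by apply/eqP; rewrite -subr_eq0 !normCK -d0 /d; apply/eqP; ring.
  have wIm : complex.Im w != 0.
    by apply: contra wNreal; case: (w) => wr wi; rewrite complex_real.
  have [p p0 pE] : exists2 p : R, 0 <= p & `|a| ^+ 2 = p%:C.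
    by rewrite -add_Re2_Im2; eexists; last by []; rewrite addr_ge0 ?sqr_ge0.
  have [q q0 qE] : exists2 q : R, 0 <= q & `|b| ^+ 2 = q%:C.
    by rewrite -add_Re2_Im2; eexists; last by []; rewrite addr_ge0 ?sqr_ge0.
  have pq : p + q = 0.
    move: dE wIm; rewrite pE qE; case: (w) => wr wi.
    move=> /(congr1 (@complex.Im R)) /= E wi0.
    apply/eqP; have : wi * (p + q) == 0 by apply/eqP; lra.
    by rewrite mulf_eq0 (negbTE wi0).
  have [p00 q00] : p = 0 /\ q = 0 by split; lra.
  by move: pE qE; rewrite p00 q00 => /eqP + /eqP; rewrite !sqrf_eq0 !normr_eq0
    => /eqP -> /eqP ->.
case: y Gy => y1 y2 Gy; rewrite (eP y1) (scalar_model_fP y2).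
move: (dot y1 e) (dot y2 f) => p q.
(* Cramer's rule for [y = s v + t (T v)]. *)
pose s := (p * (w^* * a^*) - q * (w * b^*)) / d.
pose t := (a * q - b * p) / d.
have := G1lin s _ _ Gv (G1lin t _ _ GTv G10).
rewrite addr0; congr G1; congr pair; rewrite /= !scalerA -scalerDl; congr (_ *: _).
  by rewrite /s /t /d; field; exact: d0.
by rewrite /s /t /d; field; exact: d0.
Qed.

End scalar_model.
End model.

(** * Unitary equivalence *)

Section unitary_equivalence.
Variable R : realType.

(** The adjoint of a surjective isometry is its inverse, so conjugating [T] reduces to the
    intertwining relation. *)
Lemma unitarily_equivalent_of_map (H K : hilbertType R) (T : operator H H)
    (S : K -> K) (g : H -> K) :
  (forall a x y, g (a *: x + y) = a *: g x + g y) ->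
  (forall x y, dot (g x) (g y) = dot x y) -> (forall y, exists x, g x = y) ->
  dom T = setT -> (forall x, g (T x) = S (g x)) ->
  unitarily_equivalent T (total_op S).
Proof.
move=> glin gdot gsurj Tall gT.
pose U : {linear H -> K} := HB.pack g (GRing.isLinear.Build _ _ _ _ g glin).
have adj x : dom (adjoint (total_op U)) (g x) /\ adjoint (total_op U) (g x) = x.
  apply: adjointE; first by move=> O [y Oy] _; exists y.
  by move=> y _; exact: gdot.
exists U; split; first by split.
split=> [|y _].
  apply/seteqP; split=> // y _; have [x <-] := gsurj y.
  by split=> //; split; [exact: (adj x).1|rewrite Tall].
have [x <-] := gsurj y.
have -> : op_comp (total_op U) (op_comp T (adjoint (total_op U))) (g x) =
  g (T (adjoint (total_op U) (g x))) by [].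
by rewrite (adj x).2 gT.
Qed.

Lemma span_dot (H : hilbertType R) (e : H) : dot e e = 1 ->
  (forall x, x = dot x e *: e) ->
  forall x y, dot x y = dot x e * (dot y e)^*.
Proof. by move=> ee eP x y; rewrite {1}(eP y) dotZr mulrC. Qed.

(** The cosine [c] lies in [[0, 1)], with [c < 1] because [z] has a positive imaginary part, and
    [acos] is decreasing. *)
Lemma carg_first_quadrant (z : R[i]) : 0 <= complex.Re z -> 0 < complex.Im z ->
  0 < carg z <= pi / 2.
Proof.
move=> Re0 Im0; have z0 : z != 0.
  by apply: contraTneq Im0 => ->; rewrite ltxx.
have [r0 _ r2 cle] := carg_aux z0; rewrite /carg (ltW Im0).
set c := _ / _ in cle *.
have c1 : c < 1.
  rewrite /c ltr_pdivrMr // mul1r -(@ltr_pXn2r _ 2) ?nnegrE ?(ltW r0) //.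
  by rewrite r2 ltrDl exprn_gt0.
have c0 : 0 <= c by rewrite divr_ge0 // ltW.
apply/andP; split; first by apply: acos_gt0; case/andP: cle => ->.
rewrite -acos0 leNgt; apply/negP => lt.
have : cos (acos c) < cos (acos 0).
  rewrite ltr_cos ?in_itv //= ?acos_ge0 ?acos_lepi //; apply/andP; lra.
by rewrite !acosK ?in_itv //= ?ltNge ?c0 //; apply/andP; lra.
Qed.

Section scalar_model_equivalence.
Variables (H1 H2 : hilbertType R).
Variables (N1 : operator H1 H1) (N2 : operator H2 H2).
Variables (C1 : H1 -> H2) (C2 : H2 -> H1).
Hypothesis HT : model_data N1 N2 C1 C2.
Local Notation T := (model_op N1 N2 C1 C2).
Variables (w : R[i]) (e : H1).
Hypotheses (Nall : dom N1 = setT) (NE : forall x, N1 x = w *: x).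
Hypotheses (ee : dot e e = 1) (eP : forall x, x = dot x e *: e).
Local Notation f := (C1 e).
Local Notation K := (hsum (Chilbert R) (Chilbert R)).

Let ff : dot f f = 1 := scalar_model_ff HT ee.
Let fP : forall y, y = dot y f *: f := scalar_model_fP HT eP.

Lemma scalar_model_dotT x :
  dot (T x).1 e = w * (dot x.2 f)^* /\ dot (T x).2 f = w^* * (dot x.1 e)^*.
Proof.
have -> : x = ((dot x.1 e *: e, dot x.2 f *: f) : hsum H1 H2).
  by case: x => x1 x2; congr pair; [exact: eP|exact: fP].
rewrite (scalar_model_coord HT e Nall NE) /= !dotZl ee ff !mulr1.
by [].
Qed.

(** The hypotheses make [s] a sign, applied to the coordinate along [e]. The companion lemma also
    swaps the two coordinates, which replaces [w^*] by [w]. *)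
Lemma scalar_model_equiv (s : R[i]) : s^* = s -> s * s = 1 ->
  unitarily_equivalent T (Tz (s * w^*)).
Proof.
move=> sJ ss.
pose g (x : hsum H1 H2) : K := (s * dot x.1 e, dot x.2 f).
apply: (@unitarily_equivalent_of_map _ _ _ _ g) => [a x y|x y|[a b]||x].
- rewrite /g /= !dotDl !dotZl; congr pair.
  by rewrite mulrDr mulrCA.
- have -> : dot (g x) (g y) = s * dot x.1 e * (s * dot y.1 e)^* +
    dot x.2 f * (dot y.2 f)^* by [].
  have -> : dot x y = dot x.1 y.1 + dot x.2 y.2 by [].
  rewrite (span_dot ee eP x.1 y.1) (span_dot ff fP x.2 y.2) rmorphM /= sJ; congr (_ + _).
  by rewrite mulrACA ss mul1r.
- exists ((s * (a : R[i])) *: e, (b : R[i]) *: f).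
  by rewrite /g /= !dotZl ee ff !mulr1 mulrA ss mul1r.
- exact: scalar_model_dom HT Nall.
have [d1 d2] := scalar_model_dotT x.
rewrite /g d1 d2 /Tz_fun /= !rmorphM /= sJ conjCK; congr pair; first by rewrite mulrA.
by rewrite mulrACA ss mul1r.
Qed.

Lemma scalar_model_equiv_swap (s : R[i]) : s^* = s -> s * s = 1 ->
  unitarily_equivalent T (Tz (s * w)).
Proof.
move=> sJ ss.
pose g (x : hsum H1 H2) : K := (s * dot x.2 f, dot x.1 e).
apply: (@unitarily_equivalent_of_map _ _ _ _ g) => [a x y|x y|[a b]||x].
- rewrite /g /= !dotDl !dotZl; congr pair.
  by rewrite mulrDr mulrCA.
- have -> : dot (g x) (g y) = s * dot x.2 f * (s * dot y.2 f)^* +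
    dot x.1 e * (dot y.1 e)^* by [].
  have -> : dot x y = dot x.1 y.1 + dot x.2 y.2 by [].
  rewrite (span_dot ee eP x.1 y.1) (span_dot ff fP x.2 y.2) rmorphM /= sJ addrC.
  by congr (_ + _); rewrite mulrACA ss mul1r.
- exists ((b : R[i]) *: e, (s * (a : R[i])) *: f).
  by rewrite /g /= !dotZl ee ff !mulr1 mulrA ss mul1r.
- exact: scalar_model_dom HT Nall.
have [d1 d2] := scalar_model_dotT x.
rewrite /g d1 d2 /Tz_fun /= !rmorphM /= sJ; congr pair; first by rewrite mulrA.
by rewrite mulrACA ss mul1r.
Qed.

Lemma scalar_model_Tz : w \isn't Num.real ->
  exists z : R[i], [/\ z != 0, 0 < carg z <= pi / 2 & unitarily_equivalent T (Tz z)].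
Proof.
move=> wNreal.
have wIm : complex.Im w != 0.
  by apply: contra wNreal; case: (w) => wr wi; rewrite complex_real.
(* The representative in the first quadrant among [w], [w^*], [- w] and [- w^*], all four of which
   are available as parameters. *)
pose z : R[i] := `|complex.Re w| +i* `|complex.Im w|.
have Im0 : 0 < complex.Im z by rewrite /= normr_gt0.
exists z; split.
- by apply: contraTneq Im0 => ->; rewrite ltxx.
- by apply: carg_first_quadrant; rewrite /= ?normr_ge0.
have one : (1 : R[i])^* = 1 /\ (1 : R[i]) * 1 = 1 by rewrite conjC1 mulr1.
have mone : (-1 : R[i])^* = -1 /\ (-1 : R[i]) * -1 = 1.
  by rewrite rmorphN /= conjC1 mulrNN mulr1.
have [E1 E2 E3 E4] := And4 (scalar_model_equiv one.1 one.2)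
  (scalar_model_equiv_swap one.1 one.2) (scalar_model_equiv mone.1 mone.2)
  (scalar_model_equiv_swap mone.1 mone.2).
rewrite !mul1r !mulN1r in E1 E2 E3 E4.
rewrite /z; case: (w) E1 E2 E3 E4 => a b E1 E2 E3 E4 /=.
have [a0|a0] := ger0P a; have [b0|b0] := ger0P b; [exact: E2|exact: E1| |exact: E4].
suff -> : (- a) +i* b = - (a +i* b)^* :> R[i] by exact: E3.
by apply/eqP; rewrite eq_complex /= opprK !eqxx.
Qed.

End scalar_model_equivalence.
End unitary_equivalence.

Theorem proposition19 (R : realType) (H1 H2 : hilbertType R)
    (N1 : operator H1 H1) (N2 : operator H2 H2)
    (C1 : H1 -> H2) (C2 : H2 -> H1)
    (Hneq0 : exists x : hsum H1 H2, x != 0)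
    (HT : model_data N1 N2 C1 C2) :
  [/\ (irreducible (model_op N1 N2 C1 C2) -> has_dim H1 1)
        /\ (has_dim H1 1 <-> has_dim H2 1),
      has_dim H1 1 ->
        (exists z : R[i], z \isn't Num.real /\
           op_eq N1 (total_op (fun x : H1 => z *: x))) ->
        irreducible (model_op N1 N2 C1 C2) &
      irreducible (model_op N1 N2 C1 C2) ->
        exists z : R[i], [/\ z != 0, 0 < carg z <= pi / 2 &
          unitarily_equivalent (model_op N1 N2 C1 C2) (Tz z)]].
Proof.
split; [split| |].
- move=> /(model_irreducible_span HT Hneq0) [w [e [_ _ ee eP]]].
  apply/has_dim1P; exists e => [|x]; last by exists (dot x e).
  by apply/eqP => e0; move/eqP: ee; rewrite e0 dot0l eq_sym oner_eq0.
- split=> /has_dim1P h; apply/has_dim1P; exact/(model_span12 HT).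
- move=> /has_dim1P/unit_span [e [ee eP]] [w [wNreal [Nall NE]]].
  have NwE x : N1 x = w *: x by apply: NE; rewrite Nall.
  exact (scalar_model_irreducible HT Nall NwE eP wNreal).
move=> Tirr; have [w [e [Nall NE ee eP]]] := model_irreducible_span HT Hneq0 Tirr.
apply: (scalar_model_Tz HT Nall NE ee eP).
exact: (scalar_model_nonreal HT Nall NE ee Tirr).
Qed.
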